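(* Let $\mathbb{H}$ be a graded Hecke algebra and let $(J_1,U_1),(J_2,U_2)\in\Xi_L$. If $\nu(J_1,U_1)\not\leq\nu(J_2,U_2)$ (that is, either $\nu(J_1,U_1)$ and $\nu(J_2,U_2)$ are incomparable or $\nu(J_2,U_2)<\nu(J_1,U_1)$), then for all $i$ $$\mathrm{Ext}^i_{\mathbb{H}}(I(J_1,U_1),L(J_2,U_2))=\mathrm{Ext}^i_{\mathbb{H}}(I(J_1,U_1),I(J_2,U_2))=0.$$
   Context: **Graded Hecke algebra.** $R$ is a reduced root system with simple roots $\Pi$, positive roots $R^+$ and finite reflection group $W$. $V_0$ is the real span of $R$, $V_0^\vee=\mathrm{Hom}_{\mathbb{R}}(V_0,\mathbb{R})$, $V=\mathbb{C}\otimes V_0$, $V^\vee=\mathbb{C}\otimes V_0^\vee$. The coroots $\alpha^\vee\in V_0^\vee$ satisfy $s_\alpha(v)=v-\langle v,\alpha^\vee\rangle\alpha$. For $\alpha\in\Pi$ the fundamental coweight $\omega_\alpha^\vee\in V_0^\vee$ is given by $\omega_\alpha^\vee(\beta)=\delta_{\alpha,\beta}$ ($\beta\in\Pi$). Real parts $\mathrm{Re}$ in $V^\vee$ are with respect to the real form $V_0^\vee$. $k:\Pi\to\mathbb{C}$ is a function with $k_\alpha=k_{\alpha'}$ whenever $\alpha,\alpha'$ are in the same $W$-orbit. $\mathbb{H}$ is the unital associative $\mathbb{C}$-algebra generated by $\{t_w:w\in W\}$ and $V$, containing $\mathbb{C}[W]$ (via $w\mapsto t_w$) and $S(V)$ as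 subalgebras, with relations $t_{s_\alpha}v-s_\alpha(v)t_{s_\alpha}=k_\alpha\langle v,\alpha^\vee\rangle$ ($\alpha\in\Pi$, $v\in V$). For $J\subset\Pi$, $W_J=\langle s_\alpha:\alpha\in J\rangle$, and $\mathbb{H}_J\subset\mathbb{H}$ is the subalgebra generated by $V$ and $t_w$ ($w\in W_J$). **Weights.** A weight of a finite-dimensional $\mathbb{H}_J$-module $U$ is a $\gamma^\vee\in V^\vee$ for which some $0\ne u\in U$ satisfies $(v-\gamma^\vee(v))^r u=0$ for all $v\in V$ and some positive integer $r$. **Tempered modules.** An $\mathbb{H}_J$-module $U$ is $\mathbb{H}_J$-tempered if every weight $\gamma^\vee$ has $\mathrm{Re}\,\gamma^\vee=\sum_{\alpha\in J}a_\alpha\alpha^\vee+\sum_{\alpha\in\Pi\setminus J}b_\alpha\omega_\alpha^\vee$ with $a_\alpha\le 0$, $b_\alpha>0$. If moreover $U$ is irreducible, $\nu(J,U)=\sum_{\alpha\in\Pi\setminus J}b_\alpha\omega_\alpha^\vee$ (independent of the weight chosen). **Langlands data.** $\Xi_L$ is the set of pairs $(J,U)$ with $J\subset\Pi$ and $U$ a (finite-dimensional) irreducible $\mathbb{H}_J$-tempered module. $I(J,U)=\mathbb{H}\otimes_{\mathbb{H}_J}U$ is the standard module and, for $(J,U)\in\Xi_L$, $L(J,U)$ is its unique simple quotient (Langlands classification). **Order.** For $\gamma_1^\vee,\gamma_2^\vee\in V_0^\vee$, $\gamma_1^\vee\le\gamma_2^\vee$ means $\gamma_2^\vee-\gamma_1^\vee=\sum_{\alpha\in\Pi}a_\alpha\alpha^\vee$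 with all $a_\alpha\ge0$; $\gamma_1^\vee<\gamma_2^\vee$ means in addition $\gamma_1^\vee\neq\gamma_2^\vee$. $\mathrm{Ext}$ is taken in the category of all modules. *)

(* Defs.v *)
From HB Require Import structures.
From mathcomp Require Import all_boot all_order all_algebra.
From mathcomp Require Import boolp classical_sets reals complex.

Set Implicit Arguments.
Unset Strict Implicit.
Unset Printing Implicit Defensive.

Import GRing.Theory.

Local Open Scope ring_scope.
Local Open Scope quotient_scope.
Local Open Scope complex_scope.

Section GeneratedSubalgebra.
Variables (K : comNzRingType) (A : algType K) (G : A -> Prop).

Definition in_subalg : {pred A} := fun h =>
  `[< forall S : {pred A},
        subalg_closed S -> (forall g, G g -> g \in S) -> h \in S >].

Lemma in_subalg_gen g : G g -> g \in in_subalg.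
Proof. by move=> Gg; apply/asboolP => S _; apply. Qed.

Fact in_subalg_closed : subalg_closed in_subalg.
Proof.
split.
- by apply/asboolP => S [].
- move=> a u v /asboolP Su /asboolP Sv; apply/asboolP => S cS GS.
  by case: (cS) => _ Slin _; apply: Slin; [apply: Su | apply: Sv].
- move=> u v /asboolP Su /asboolP Sv; apply/asboolP => S cS GS.
  by case: (cS) => _ _ SM; apply: SM; [apply: Su | apply: Sv].
Qed.

Record subalg := Subalg { subalg_val : A; subalg_valP : subalg_val \in in_subalg }.

HB.instance Definition _ := [isSub for subalg_val].
HB.instance Definition _ := [Choice of subalg by <:].
HB.instance Definition _ := GRing.SubChoice_isSubAlgebra.Build K A _ subalg
  (GRing.subalg_closed_semi in_subalg_closed).
HB.instance Definition _ :=
  GRing.RMorphism.copy subalg_val (\val : subalg -> A).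

Definition subalg_gen g (Gg : G g) : subalg := Subalg (in_subalg_gen Gg).

End GeneratedSubalgebra.

Section ExtendScalars.
Variables (A B : nzRingType) (phi : {rmorphism A -> B}) (U : lmodType A).

(** A finite sequence [(b_1, u_1), ..., (b_m, u_m)] stands for the sum of the
    [b_i (x) u_i]; [tens_eq] is the congruence of the free commutative monoid
    on [B * U] generated by additivity in each variable and
    [(b * phi a) (x) u = b (x) (a *: u)]. *)
Inductive tens_eq : seq (B * U) -> seq (B * U) -> Prop :=
| tens_refl s : tens_eq s s
| tens_sym s s' : tens_eq s s' -> tens_eq s' s
| tens_trans s1 s2 s3 : tens_eq s1 s2 -> tens_eq s2 s3 -> tens_eq s1 s3
| tens_cat s1 s2 s1' s2' :
    tens_eq s1 s1' -> tens_eq s2 s2' -> tens_eq (s1 ++ s2) (s1' ++ s2')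
| tens_comm s1 s2 : tens_eq (s1 ++ s2) (s2 ++ s1)
| tens_0l u : tens_eq [:: (0, u)] [::]
| tens_Dl b b' u : tens_eq [:: (b + b', u)] [:: (b, u); (b', u)]
| tens_Dr b u u' : tens_eq [:: (b, u + u')] [:: (b, u); (b, u')]
| tens_bal b a u : tens_eq [:: (b * phi a, u)] [:: (b, a *: u)].

Definition tens_eqb : rel (seq (B * U)) := fun s s' => `[< tens_eq s s' >].

Fact tens_equiv : equiv_class_of tens_eqb.
Proof.
split.
- by move=> s; apply/asboolP/tens_refl.
- by move=> s s'; apply/asboolP/asboolP => /tens_sym.
- by move=> s2 s1 s3 /asboolP h1 /asboolP h2; apply/asboolP/(tens_trans h1).
Qed.

Canonical tens_equiv_rel := EquivRelPack tens_equiv.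

Definition extend_scalars := {eq_quot tens_eqb}.
HB.instance Definition _ := Choice.on extend_scalars.
HB.instance Definition _ := EqQuotient.on extend_scalars.

Lemma tensP s s' : reflect (tens_eq s s') (s == s' %[mod extend_scalars]).
Proof. by rewrite piE; apply: asboolP. Qed.

Lemma tensW s s' : tens_eq s s' -> \pi_extend_scalars s = \pi_extend_scalars s'.
Proof. by move=> h; apply/eqP/tensP. Qed.

Lemma tens_repr s : tens_eq (repr (\pi_extend_scalars s)) s.
Proof. by apply/tensP; rewrite reprK. Qed.

Lemma tens_quotW (P : extend_scalars -> Prop) :
  (forall s, P (\pi_extend_scalars s)) -> forall x, P x.
Proof. by move=> Ps x; rewrite -[x]reprK. Qed.

Definition tens_lscale (c : B) (s : seq (B * U)) : seq (B * U) :=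
  [seq (c * p.1, p.2) | p <- s].

Lemma tens_lscaleP c s s' :
  tens_eq s s' -> tens_eq (tens_lscale c s) (tens_lscale c s').
Proof.
elim=> {s s'} /=; rewrite /tens_lscale.
- by move=> s; apply: tens_refl.
- by move=> s s' _ ?; apply: tens_sym.
- by move=> s1 s2 s3 _ h1 _ h2; apply: tens_trans h1 h2.
- by move=> s1 s2 s1' s2' _ h1 _ h2; rewrite !map_cat; apply: tens_cat.
- by move=> s1 s2; rewrite !map_cat; apply: tens_comm.
- by move=> u; rewrite mulr0; apply: tens_0l.
- by move=> b b' u; rewrite mulrDr; apply: tens_Dl.
- by move=> b u u'; apply: tens_Dr.
- by move=> b a u; rewrite mulrA; apply: tens_bal.
Qed.

Lemma tens_lscaleDl b c s :
  tens_eq (tens_lscale (b + c) s) (tens_lscale b s ++ tens_lscale c s).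
Proof.
elim: s => [|[d u] s IH]; first exact: tens_refl.
rewrite /= mulrDl.
have := tens_cat (tens_Dl (b * d) (c * d) u) IH; move/tens_trans; apply.
apply: (@tens_cat [:: (b * d, u)] _ [:: (b * d, u)]); first exact: tens_refl.
rewrite -/(tens_lscale b s) -/(tens_lscale c s).
rewrite -[in X in tens_eq _ X]cat1s !catA -[_ :: _ ++ _]cat1s catA.
by apply: tens_cat; [exact: tens_comm | exact: tens_refl].
Qed.

Lemma tens_lscale0 s : tens_eq (tens_lscale 0 s) [::].
Proof.
elim: s => [|[d u] s IH] /=; first exact: tens_refl.
by rewrite mul0r -cat1s -[[::]]/([::] ++ [::]); apply: tens_cat (tens_0l u) IH.
Qed.

Definition tens_add (x y : extend_scalars) : extend_scalars :=
  \pi_extend_scalars (repr x ++ repr y).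
Definition tens_scale (c : B) (x : extend_scalars) : extend_scalars :=
  \pi_extend_scalars (tens_lscale c (repr x)).

Lemma tens_addE s s' :
  tens_add (\pi_extend_scalars s) (\pi_extend_scalars s') =
  \pi_extend_scalars (s ++ s').
Proof. by apply/tensW/tens_cat; apply: tens_repr. Qed.

Lemma tens_scaleE c s :
  tens_scale c (\pi_extend_scalars s) = \pi_extend_scalars (tens_lscale c s).
Proof. by apply/tensW/tens_lscaleP/tens_repr. Qed.

Fact tens_addA : associative tens_add.
Proof.
move=> x y z; elim/tens_quotW: x => x; elim/tens_quotW: y => y; elim/tens_quotW: z => z.
by rewrite !tens_addE catA.
Qed.

Fact tens_addC : commutative tens_add.
Proof.
move=> x y; elim/tens_quotW: x => x; elim/tens_quotW: y => y.
by rewrite !tens_addE; apply/tensW/tens_comm.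
Qed.

Fact tens_add0 : left_id (\pi_extend_scalars [::]) tens_add.
Proof. by move=> x; elim/tens_quotW: x => x; rewrite tens_addE. Qed.

Fact tens_addN : left_inverse (\pi_extend_scalars [::]) (tens_scale (-1)) tens_add.
Proof.
move=> x; elim/tens_quotW: x => x; rewrite tens_scaleE tens_addE; apply: tensW.
apply: tens_trans (tens_lscale0 x).
rewrite -[in X in tens_eq _ X](addNr (1 : B)).
apply: tens_trans (tens_sym (tens_lscaleDl _ _ _)).
apply: tens_cat; first exact: tens_refl.
rewrite /tens_lscale (eq_map (_ : _ =1 id)) ?map_id; first exact: tens_refl.
by case=> b u /=; rewrite mul1r.
Qed.

HB.instance Definition _ := GRing.isZmodule.Build extend_scalars
  tens_addA tens_addC tens_add0 tens_addN.

Lemma tens_piD s s' :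
  \pi_extend_scalars s + \pi_extend_scalars s' = \pi_extend_scalars (s ++ s').
Proof. exact: tens_addE. Qed.

Fact tens_scaleA a b x : tens_scale a (tens_scale b x) = tens_scale (a * b) x.
Proof.
elim/tens_quotW: x => x; rewrite !tens_scaleE /tens_lscale -map_comp.
by congr \pi; apply: eq_map => -[c u] /=; rewrite mulrA.
Qed.

Fact tens_scale1 : left_id 1 tens_scale.
Proof.
move=> x; elim/tens_quotW: x => x; rewrite tens_scaleE /tens_lscale; congr \pi.
by rewrite -[RHS]map_id; apply: eq_map => -[c u] /=; rewrite mul1r.
Qed.

Fact tens_scaleDr : right_distributive tens_scale +%R.
Proof.
move=> c x y; elim/tens_quotW: x => x; elim/tens_quotW: y => y.
by rewrite tens_piD !tens_scaleE tens_piD /tens_lscale map_cat.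
Qed.

Fact tens_scaleDl x : {morph tens_scale^~ x : a b / a + b}.
Proof.
move=> a b; elim/tens_quotW: x => x; rewrite !tens_scaleE.
by rewrite tens_piD; apply/tensW/tens_lscaleDl.
Qed.

HB.instance Definition _ := GRing.Zmodule_isLmodule.Build B extend_scalars
  tens_scaleA tens_scale1 tens_scaleDr tens_scaleDl.

Definition tens (b : B) (u : U) : extend_scalars := \pi_extend_scalars [:: (b, u)].

End ExtendScalars.

Definition irreducible (A : nzRingType) (U : lmodType A) : Prop :=
  (exists u : U, u != 0) /\
  forall S : {pred U}, submod_closed S ->
    (forall u, u \in S -> u = 0) \/ (forall u, u \in S).

Definition surjective_map (T T' : Type) (f : T -> T') : Prop :=
  forall y, exists x, f x = y.

Definition simple_quotient (A : nzRingType) (M L : lmodType A) : Prop :=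
  irreducible L /\ exists p : {linear M -> L}, surjective_map p.

Definition finite_dim (K : comNzRingType) (A : algType K) (U : lmodType A) : Prop :=
  exists (m : nat) (b : 'I_m -> U),
    forall u, exists c : 'I_m -> K, u = \sum_(i < m) (c i)%:A *: b i.

Definition projective (A : nzRingType) (P : lmodType A) : Prop :=
  forall (M N : lmodType A) (g : {linear M -> N}) (f : {linear P -> N}),
    surjective_map g -> exists h : {linear P -> M}, forall x, g (h x) = f x.

(** [... -> P 2 -> P 1 -> P 0 -> M -> 0] exact with every [P i] projective;
    [pres_d P i : P i.+1 -> P i]. *)
Record proj_resolution (A : nzRingType) (M : lmodType A) := ProjResolution {
  pres_obj :> nat -> lmodType A;
  pres_d : forall i, {linear pres_obj i.+1 -> pres_obj i};
  pres_aug : {linear pres_obj 0%N -> M};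
  pres_proj : forall i, projective (pres_obj i);
  pres_aug_surj : surjective_map pres_aug;
  pres_exact0 : forall x, pres_aug x = 0 <-> exists y, pres_d 0%N y = x;
  pres_exact : forall i x, pres_d i x = 0 <-> exists y, pres_d i.+1 y = x
}.

Section FreeModule.
Variables (A : nzRingType) (X : choiceType).

Definition lcomb (M : lmodType A) (f : X -> M) (s : seq (A * X)) : M :=
  \sum_(p <- s) p.1 *: f p.2.

Definition free_eqb : rel (seq (A * X)) := fun s s' =>
  `[< forall (M : lmodType A) (f : X -> M), lcomb f s = lcomb f s' >].

Fact free_equiv : equiv_class_of free_eqb.
Proof.
split.
- by move=> s; apply/asboolP.
- by move=> s s'; apply/asboolP/asboolP => h M f; rewrite h.
- by move=> s2 s1 s3 /asboolP h1 /asboolP h2; apply/asboolP => M f; rewrite h1.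
Qed.

Canonical free_equiv_rel := EquivRelPack free_equiv.

Definition free_mod := {eq_quot free_eqb}.
HB.instance Definition _ := Choice.on free_mod.
HB.instance Definition _ := EqQuotient.on free_mod.

Lemma free_quotW (P : free_mod -> Prop) :
  (forall s, P (\pi_free_mod s)) -> forall x, P x.
Proof. by move=> Ps x; rewrite -[x]reprK. Qed.

Lemma free_piE s s' : (forall (M : lmodType A) (f : X -> M), lcomb f s = lcomb f s') ->
  \pi_free_mod s = \pi_free_mod s'.
Proof. by move=> h; apply/eqP; rewrite piE; apply/asboolP. Qed.

Lemma free_repr (M : lmodType A) (f : X -> M) s :
  lcomb f (repr (\pi_free_mod s)) = lcomb f s.
Proof.
have: repr (\pi_free_mod s) == s %[mod free_mod] by rewrite reprK.
by rewrite piE => /asboolP ->.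
Qed.

Definition free_lscale (c : A) (s : seq (A * X)) := [seq (c * p.1, p.2) | p <- s].

Lemma lcomb_cat (M : lmodType A) (f : X -> M) s s' :
  lcomb f (s ++ s') = lcomb f s + lcomb f s'.
Proof. exact: big_cat. Qed.

Lemma lcomb_lscale (M : lmodType A) (f : X -> M) c s :
  lcomb f (free_lscale c s) = c *: lcomb f s.
Proof.
rewrite /lcomb big_map scaler_sumr; apply: eq_bigr => p _.
by rewrite scalerA.
Qed.

Definition free_add (x y : free_mod) : free_mod := \pi_free_mod (repr x ++ repr y).
Definition free_scale (c : A) (x : free_mod) : free_mod :=
  \pi_free_mod (free_lscale c (repr x)).

Definition freeE := (free_repr, lcomb_cat, lcomb_lscale).

Fact free_addA : associative free_add.
Proof. by move=> x y z; apply: free_piE => M f; rewrite !freeE addrA. Qed.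

Fact free_addC : commutative free_add.
Proof. by move=> x y; apply: free_piE => M f; rewrite !freeE addrC. Qed.

Fact free_add0 : left_id (\pi_free_mod [::]) free_add.
Proof.
move=> x; rewrite -[RHS]reprK; apply: free_piE => M f.
by rewrite !freeE /lcomb big_nil add0r.
Qed.

Fact free_addN : left_inverse (\pi_free_mod [::]) (free_scale (-1)) free_add.
Proof.
move=> x; apply: free_piE => M f.
by rewrite !freeE scaleN1r addNr /lcomb big_nil.
Qed.

HB.instance Definition _ := GRing.isZmodule.Build free_mod
  free_addA free_addC free_add0 free_addN.

Fact free_scaleA a b x : free_scale a (free_scale b x) = free_scale (a * b) x.
Proof. by apply: free_piE => M f; rewrite !freeE scalerA. Qed.

Fact free_scale1 : left_id 1 free_scale.
Proof.
by move=> x; rewrite -[RHS]reprK; apply: free_piE => M f; rewrite !freeE scale1r.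
Qed.

Fact free_scaleDr : right_distributive free_scale +%R.
Proof. by move=> c x y; apply: free_piE => M f; rewrite !freeE scalerDr. Qed.

Fact free_scaleDl x : {morph free_scale^~ x : a b / a + b}.
Proof. by move=> a b; apply: free_piE => M f; rewrite !freeE scalerDl. Qed.

HB.instance Definition _ := GRing.Zmodule_isLmodule.Build A free_mod
  free_scaleA free_scale1 free_scaleDr free_scaleDl.

Definition free_gen (x : X) : free_mod := \pi_free_mod [:: (1, x)].

Section Lift.
Variables (M : lmodType A) (f : X -> M).

Definition free_lift (x : free_mod) : M := lcomb f (repr x).

Fact free_lift_linear : linear free_lift.
Proof. by move=> c x y; rewrite /free_lift !freeE. Qed.

HB.instance Definition _ := GRing.isLinear.Build A free_mod M *:%R free_lift
  free_lift_linear.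

Lemma free_liftE x : free_lift (free_gen x) = f x.
Proof. by rewrite /free_lift free_repr /lcomb big_seq1 scale1r. Qed.

End Lift.

Lemma free_piS s : \pi_free_mod s = \sum_(p <- s) p.1 *: free_gen p.2.
Proof.
elim: s => [|[a x] s IH]; first by rewrite big_nil.
rewrite big_cons -IH; apply: free_piE => M f; rewrite !freeE /=.
by rewrite /lcomb big_cons big_seq1 /= scale1r.
Qed.

Lemma free_projective : projective free_mod.
Proof.
move=> M N g f gsurj.
have [m gm] := choice (fun x => gsurj (f (free_gen x))).
exists (free_lift m) => x; elim/free_quotW: x => s; rewrite free_piS.
rewrite (linear_sum (free_lift m)) (linear_sum g) (linear_sum f) /=.
by apply: eq_bigr => p _; rewrite !linearZ_LR /= free_liftE gm.
Qed.

End FreeModule.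

Section Kernel.
Variables (A : nzRingType) (M N : lmodType A) (f : {linear M -> N}).

Record ker_mod := KerMod { ker_val : M; ker_valP : f ker_val == 0 }.

HB.instance Definition _ := [isSub for ker_val].
HB.instance Definition _ := [Choice of ker_mod by <:].

Fact ker_submod : submod_closed (fun x : M => f x == 0).
Proof.
split; first by rewrite unfold_in linear0.
by move=> a x y; rewrite !unfold_in linearP => /eqP -> /eqP ->; rewrite scaler0 addr0.
Qed.

HB.instance Definition _ := GRing.SubChoice_isSubLmodule.Build A M _ ker_mod
  ker_submod.

Definition ker_incl : {linear ker_mod -> M} := (\val : ker_mod -> M).

End Kernel.

Section Resolution.
Variables (A : nzRingType) (M : lmodType A).

Fixpoint syzygy (i : nat) : lmodType A :=
  if i is j.+1 then ker_mod (@free_lift A (syzygy j) (syzygy j) id) else M.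

Let P i : lmodType A := free_mod A (syzygy i).
Let aug i : {linear P i -> syzygy i} := @free_lift A (syzygy i) (syzygy i) id.
Let incl i : {linear syzygy i.+1 -> P i} := ker_incl (aug i).
Let d i : {linear P i.+1 -> P i} := (incl i \o aug i.+1)%FUN.

Let aug_surj i : surjective_map (aug i).
Proof. by move=> y; exists (free_gen A y); apply: (@free_liftE A (syzygy i) (syzygy i) id). Qed.

Let aug_exact i x : aug i x = 0 <-> exists y, d i y = x.
Proof.
split=> [/eqP x0|[y <-]]; last exact/eqP/(ker_valP (aug i.+1 y)).
by have [y yx] := @aug_surj i.+1 (KerMod x0); exists y; rewrite /d /= yx.
Qed.

Let d_exact i x : d i x = 0 <-> exists y, d i.+1 y = x.
Proof.
rewrite -aug_exact; split=> [x0|]; last first.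
  by move=> x0; rewrite /d /= x0; exact: (linear0 (incl i)).
exact: val_inj.
Qed.

Lemma proj_resolution_exists : inhabited (proj_resolution M).
Proof.
split; apply: (@ProjResolution A M P d (aug 0%N)).
- by move=> i; apply: free_projective.
- exact: aug_surj.
- exact: aug_exact.
- exact: d_exact.
Qed.

End Resolution.

Section Ext.
Variables (A : nzRingType) (M N : lmodType A).

Definition cocycle (P : proj_resolution M) i (f : P i -> N) : Prop :=
  forall y, f (pres_d P i y) = 0.

Definition coboundary (P : proj_resolution M) i : (P i -> N) -> Prop :=
  match i with
  | 0%N => fun f => forall x, f x = 0
  | j.+1 => fun f => exists g : {linear P j -> N}, forall x, f x = g (pres_d P j x)
  end.

(** [Ext^i(M, N) = 0]: the [i]-th cohomology of [Hom(P, N)] vanishes for every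
    projective resolution [P] of [M] (there is one, see
    [proj_resolution_exists]). *)
Definition Ext_eq0 (i : nat) : Prop :=
  forall (P : proj_resolution M) (f : {linear P i -> N}),
    cocycle f -> coboundary f.

End Ext.

(** The real span of the roots is ['cV[R]_n] and its dual is ['rV[R]_n], with
    [<v, g> = (g *m v) 0 0]; their complexifications are ['cV[R[i]]_n] and
    ['rV[R[i]]_n].  The values of [coroot] outside [roots] are irrelevant.
    That the roots span follows from [simple_free]. *)
Record root_system (R : realType) (n : nat) := RootSystem {
  roots : seq 'cV[R]_n;
  coroot : 'cV[R]_n -> 'rV[R]_n;
  simple : 'I_n -> 'cV[R]_n;
  root_neq0 : 0 \notin roots;
  coroot2 : {in roots, forall a, (coroot a *m a) 0 0 = 2};
  root_stable :
    {in roots &, forall a b, b - (coroot a *m b) 0 0 *: a \in roots};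
  root_reduced :
    {in roots, forall a c, c *: a \in roots -> c = 1 \/ c = -1};
  simple_root : forall i, simple i \in roots;
  simple_free : forall c : 'I_n -> R,
    \sum_i c i *: simple i = 0 -> forall i, c i = 0;
  root_pos_neg : {in roots, forall b, exists2 c : 'I_n -> R,
    b = \sum_i c i *: simple i & (forall i, 0 <= c i) \/ (forall i, c i <= 0)}
}.

Section RootSystem.
Variables (R : realType) (n : nat) (Phi : root_system R n).

Definition scoroot (i : 'I_n) : 'rV[R]_n := coroot Phi (simple Phi i).

(** [refl a *m v = v - <v, a^vee> a] *)
Definition refl (a : 'cV[R]_n) : 'M[R]_n := 1%:M - a *m coroot Phi a.

(** As reflections are involutions, the group they generate is the monoid they
    generate. *)
Inductive refl_group (S : 'cV[R]_n -> Prop) : 'M[R]_n -> Prop :=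
| refl_group1 : refl_group S 1%:M
| refl_groupM a w : S a -> refl_group S w -> refl_group S (refl a *m w).

Definition weyl : 'M[R]_n -> Prop := refl_group (fun a => a \in roots Phi).

Definition weyl_parab (J : {set 'I_n}) : 'M[R]_n -> Prop :=
  refl_group (fun a => exists2 i, i \in J & a = simple Phi i).

Definition coweight (i : 'I_n) : 'rV[R]_n :=
  row i (invmx (\matrix_(p, j) simple Phi j p 0)).

Lemma coweightE i j : (coweight i *m simple Phi j) 0 0 = (i == j)%:R.
Proof.
set S := \matrix_(p, j) simple Phi j p 0.
have Scol k : col k S = simple Phi k.
  by apply/colP => p; rewrite !mxE.
have S_unit : S \in unitmx.
  rewrite -unitmx_tr -row_free_unit -kermx_eq0.
  apply/eqP/row_matrixP => r; rewrite row0.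
  have: row r (kermx S^T) *m S^T = 0 by rewrite -row_mul mulmx_ker row0.
  move: (row r _) => u uS0; apply/rowP => i'; rewrite mxE.
  apply: (@simple_free _ _ Phi (u 0)); apply/colP => p.
  move/rowP: uS0 => /(_ p); rewrite !mxE summxE => {2}<-.
  by apply: eq_bigr => q _; rewrite !mxE.
rewrite /coweight -/S -Scol -row_mul colE mulmxA.
by rewrite mulVmx // -colE !mxE.
Qed.

Definition same_weyl_orbit (a b : 'cV[R]_n) : Prop :=
  exists2 w, weyl w & w *m a = b.

Definition dominance_le (g1 g2 : 'rV[R]_n) : Prop :=
  exists2 a : 'I_n -> R, (forall i, 0 <= a i) & g2 - g1 = \sum_i a i *: scoroot i.

Definition parameter_function (k : 'I_n -> R[i]) : Prop :=
  forall i j, same_weyl_orbit (simple Phi i) (simple Phi j) -> k i = k j.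

End RootSystem.

Definition lin_indep (K : comNzRingType) (V : lmodType K) (I : eqType)
    (D : I -> Prop) (f : I -> V) : Prop :=
  forall (s : seq I) (c : I -> K), uniq s -> (forall i, i \in s -> D i) ->
    \sum_(i <- s) c i *: f i = 0 -> forall i, i \in s -> c i = 0.

Section GradedHecke.
Variables (R : realType) (n : nat) (Phi : root_system R n) (k : 'I_n -> R[i]).

Local Notation C := R[i].
Local Notation V := 'cV[C]_n.
Local Notation cmx := (map_mx (real_complex R)).

(** Only the values [t w] with [weyl Phi w] are meaningful. *)
Definition hecke_relations (A : algType C) (t : 'M[R]_n -> A)
    (x : {linear V -> A}) : Prop :=
  [/\ t 1%:M = 1,
      forall w w', weyl Phi w -> weyl Phi w' -> t (w *m w') = t w * t w',
      forall v v', x v * x v' = x v' * x v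
    & forall i v,
        t (refl Phi (simple Phi i)) * x v
          - x (cmx (refl Phi (simple Phi i)) *m v) * t (refl Phi (simple Phi i))
        = (k i * (cmx (scoroot Phi i) *m v) 0 0)%:A].

(** The algebra presented by [t_w], [w] in [W], and [V] with the relations
    above ([hecke_gen], [hecke_univ]), in which [C[W]] and [S(V)] embed
    ([hecke_CW], [hecke_SV]; a basis of [S(V)] is given by the monomials in the
    standard basis of [V]). *)
Record graded_hecke := GradedHecke {
  hecke_alg :> algType C;
  hecke_t : 'M[R]_n -> hecke_alg;
  hecke_x : {linear V -> hecke_alg};
  hecke_rel : hecke_relations hecke_t hecke_x;
  hecke_CW : lin_indep (weyl Phi) hecke_t;
  hecke_SV : lin_indep (fun=> True)
    (fun e : {ffun 'I_n -> nat} => \prod_(j < n) hecke_x (delta_mx j 0) ^+ e j);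
  hecke_gen : forall h, h \in in_subalg (fun g =>
    (exists2 w, weyl Phi w & g = hecke_t w) \/ (exists v, g = hecke_x v));
  hecke_univ : forall (A : algType C) (t : 'M[R]_n -> A) (x : {linear V -> A}),
    hecke_relations t x ->
    exists f : {lrmorphism hecke_alg -> A},
      (forall w, weyl Phi w -> f (hecke_t w) = t w) /\
      (forall v, f (hecke_x v) = x v)
}.

Variable H : graded_hecke.

Section Parabolic.
Variable J : {set 'I_n}.

Definition parab_gen (h : H) : Prop :=
  (exists2 w, weyl_parab Phi J w & h = hecke_t H w) \/
  (exists v, h = hecke_x H v).

Definition parab : algType C := subalg parab_gen.

Definition parab_incl : {rmorphism parab -> H} := @subalg_val _ _ parab_gen.

Definition parab_x (v : V) : parab :=
  subalg_gen (or_intror (ex_intro _ v erefl) : parab_gen (hecke_x H v)).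

Variable U : lmodType parab.

Definition is_weight (g : 'rV[C]_n) : Prop :=
  exists2 u : U, u != 0 & exists2 r : nat, (0 < r)%N &
    forall v : V, (parab_x v - ((g *m v) 0 0)%:A) ^+ r *: u = 0.

Definition re_weight (g : 'rV[C]_n) : 'rV[R]_n := map_mx (@complex.Re R) g.

Definition langlands_decomp (g : 'rV[R]_n) (a b : 'I_n -> R) : Prop :=
  [/\ forall i, i \in J -> a i <= 0,
      forall i, i \notin J -> 0 < b i
    & g = \sum_(i in J) a i *: scoroot Phi i
          + \sum_(i | i \notin J) b i *: coweight Phi i].

Definition tempered : Prop :=
  forall g, is_weight g -> exists a b, langlands_decomp (re_weight g) a b.

Definition langlands_datum : Prop :=
  [/\ finite_dim U, irreducible U & tempered].

(** The value is chosen among those given by all weights and decompositions;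
    for a Langlands datum there is exactly one. *)
Definition nu : 'rV[R]_n :=
  xget 0 (fun y => exists g a b,
    [/\ is_weight g, langlands_decomp (re_weight g) a b
      & y = \sum_(i | i \notin J) b i *: coweight Phi i]).

Definition standard : lmodType H := extend_scalars parab_incl U.

End Parabolic.

End GradedHecke.

(* Main.v *)
(** By Frobenius reciprocity [Ext(H (x)_{H_J1} U1, X)] is computed by [H (x) Q]
    for a projective resolution [Q] of [U1] over [H_J1], because [H] is projective
    as a right [H_J1]-module.  The latter follows from the PBW theorem: the
    intertwiners [t_s alpha - k_s] satisfy [x_v tau_w = tau_w x_(w^-1 v)], hence
    are independent over [S(V)], and so are the equally many [t_w].  A vector [v]
    orthogonal to the coroots of [J1] is central in [H_J1] and acts on [U1] by the
    scalar [g1 v], [g1] a weight of [U1], so multiplication by [v - g1 v] is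
    null-homotopic on [Q].  On [X] some product of operators [v - d v], with [d] a
    weight of [X] and [v] depending on [d], is zero; if [d v <> g1 v] for all
    factors then [Ext] is killed by a nonzero scalar.  Such [v] exist: the weights
    of [X] are among the [w g] with [g] a weight of [U2] and [w] shortest in
    [w W_J2], so [Re d <= nu(J2, U2)], whereas [d = g1] on all such [v] would give
    [nu(J1, U1) <= nu(J2, U2)]. *)
Require Import Defs.
From HB Require Import structures.
From mathcomp Require Import all_boot all_order all_algebra.
From mathcomp Require Import boolp classical_sets reals complex ring lra mpoly.
Import Defs.

Set Implicit Arguments.
Unset Strict Implicit.
Unset Printing Implicit Defensive.

Import Order.TTheory GRing.Theory Num.Theory.
Local Open Scope ring_scope.

(** * Root systems *)

(** The vector v has to be chosen separately for each weight d, so annihilation is recorded by the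
    predicate [killed]: for a list of weights, all products of the x_v - d v, with one free choice
    of v per entry, are zero. In this form it passes to sums, to extensions (by concatenating lists)
    and to quotients, hence from U2 to I(J2, U2) and on to L(J2, U2).

    The vectors orthogonal to the coroots of J1 are spanned by the fundamental weights [fweight i],
    i outside J1. If d and g1 agree on these, then nu(J2, U2) - nu(J1, U1) is nonnegative on them,
    because Re d <= nu(J2, U2), and also on the simple roots of J1, where nu(J1, U1) vanishes and
    nu(J2, U2) is dominant. Nonnegativity of the inverse Cartan matrix of J1 spreads this to all
    fundamental weights.

    Shortest w enter because they send the simple coroots of J2 to positive coroots: the nonpositive
    part of a tempered weight stays nonpositive, while the dominant part can only decrease. *)

Section Pairing.
Variables (R : comNzRingType) (n : nat).
Implicit Types (g h : 'rV[R]_n) (u v : 'cV[R]_n).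

Definition pairing g v : R := (g *m v) 0 0.

Lemma pairingDr g u v : pairing g (u + v) = pairing g u + pairing g v.
Proof. by rewrite /pairing mulmxDr mxE. Qed.
Lemma pairingNr g v : pairing g (- v) = - pairing g v.
Proof. by rewrite /pairing mulmxN mxE. Qed.
Lemma pairingBr g u v : pairing g (u - v) = pairing g u - pairing g v.
Proof. by rewrite pairingDr pairingNr. Qed.
Lemma pairingZr g c v : pairing g (c *: v) = c * pairing g v.
Proof. by rewrite /pairing -scalemxAr mxE. Qed.
Lemma pairing_sumr I (r : seq I) (P : pred I) g (F : I -> 'cV[R]_n) :
  pairing g (\sum_(i <- r | P i) F i) = \sum_(i <- r | P i) pairing g (F i).
Proof. by rewrite /pairing mulmx_sumr summxE. Qed.
Lemma pairingDl g h v : pairing (g + h) v = pairing g v + pairing h v.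
Proof. by rewrite /pairing mulmxDl mxE. Qed.
Lemma pairingNl g v : pairing (- g) v = - pairing g v.
Proof. by rewrite /pairing mulNmx mxE. Qed.
Lemma pairingBl g h v : pairing (g - h) v = pairing g v - pairing h v.
Proof. by rewrite pairingDl pairingNl. Qed.
Lemma pairingZl g c v : pairing (c *: g) v = c * pairing g v.
Proof. by rewrite /pairing -scalemxAl mxE. Qed.
Lemma pairing_suml I (r : seq I) (P : pred I) (F : I -> 'rV[R]_n) v :
  pairing (\sum_(i <- r | P i) F i) v = \sum_(i <- r | P i) pairing (F i) v.
Proof. by rewrite /pairing mulmx_suml summxE. Qed.
Lemma pairing0r g : pairing g 0 = 0.
Proof. by rewrite /pairing mulmx0 mxE. Qed.
Lemma pairingM g (w : 'M[R]_n) v : pairing (g *m w) v = pairing g (w *m v).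
Proof. by rewrite /pairing mulmxA. Qed.
Lemma pairing_trl u v : pairing u^T v = \sum_k u k 0 * v k 0.
Proof. by rewrite /pairing mxE; apply: eq_bigr => k _; rewrite mxE. Qed.

Lemma mulmx_ext (A B : 'M[R]_n) : (forall v, A *m v = B *m v) -> A = B.
Proof.
move=> h; apply/matrixP => i j; have /colP /(_ i) := h (delta_mx j 0).
by rewrite -!colE !mxE.
Qed.

End Pairing.

Section RootSystemTheory.
Variables (R : realType) (n : nat) (Phi : root_system R n).

Local Notation al := (simple Phi).
Local Notation cor := (scoroot Phi).
Local Notation om := (coweight Phi).
Local Notation s i := (refl Phi (simple Phi i)).
Local Notation roots := (roots Phi).
Implicit Types (i j : 'I_n) (a b v : 'cV[R]_n) (w : 'M[R]_n) (q : seq 'I_n).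

Lemma reflE a v : refl Phi a *m v = v - pairing (coroot Phi a) v *: a.
Proof.
rewrite /refl mulmxBl mul1mx -mulmxA; congr (_ - _).
by rewrite [X in a *m X]mx11_scalar mul_mx_scalar.
Qed.

Lemma refl_simpleE i v : s i *m v = v - pairing (cor i) v *: al i.
Proof. exact: reflE. Qed.

Lemma refl_invol a : a \in roots -> refl Phi a *m refl Phi a = 1%:M.
Proof.
move=> ha; have h2 := coroot2 ha.
rewrite {2}/refl mulmxBr mulmx1 mulmxA reflE /pairing h2.
by rewrite scaler_nat mulr2n opprD addrA subrr sub0r mulNmx opprK subrK.
Qed.

Lemma scorootK i : pairing (cor i) (al i) = 2.
Proof. exact: coroot2 (simple_root Phi i). Qed.

Lemma refl_simpleK i : s i *m s i = 1%:M.
Proof. exact: refl_invol (simple_root Phi i). Qed.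

Lemma refl_simpleN i : s i *m al i = - al i.
Proof.
by rewrite refl_simpleE scorootK scaler_nat mulr2n opprD addrA subrr sub0r.
Qed.

Lemma refl_root a b : a \in roots -> b \in roots -> refl Phi a *m b \in roots.
Proof. by move=> ha hb; rewrite reflE; apply: root_stable. Qed.

Lemma root_opp a : a \in roots -> - a \in roots.
Proof.
move=> ha; have := refl_root ha ha; rewrite reflE /pairing coroot2 //.
by rewrite scaler_nat mulr2n opprD addrA subrr sub0r.
Qed.

Lemma weyl_root w b : weyl Phi w -> b \in roots -> w *m b \in roots.
Proof.
move=> hw; elim: hw b => {w} [|a w ha _ IH] b hb; first by rewrite mul1mx.
by rewrite -mulmxA refl_root // IH.
Qed.

Lemma weylM w w' : weyl Phi w -> weyl Phi w' -> weyl Phi (w *m w').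
Proof.
elim=> {w} [|a w ha _ IH] hw'; first by rewrite mul1mx.
by rewrite -mulmxA; apply: refl_groupM => //; apply: IH.
Qed.

Lemma weyl_refl a : a \in roots -> weyl Phi (refl Phi a).
Proof.
by move=> ha; rewrite -[refl _ _]mulmx1; apply: refl_groupM => //; apply: refl_group1.
Qed.

Lemma weyl_simple i : weyl Phi (s i).
Proof. exact/weyl_refl/simple_root. Qed.

Lemma weyl_unit w : weyl Phi w -> w \in unitmx.
Proof.
elim=> {w} [|a w ha _ IH]; first exact: unitmx1.
rewrite unitmx_mul IH andbT.
by have [] := mulmx1_unit (refl_invol ha).
Qed.

Lemma invmx_refl a : a \in roots -> invmx (refl Phi a) = refl Phi a.
Proof.
move=> ha; have h := refl_invol ha; have [u _] := mulmx1_unit h.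
by rewrite -[LHS]mulmx1 -h mulmxA mulVmx // mul1mx.
Qed.

Lemma invmxM w w' : w \in unitmx -> w' \in unitmx ->
  invmx (w *m w') = invmx w' *m invmx w.
Proof.
move=> hw hw'; have hu : w *m w' \in unitmx by rewrite unitmx_mul hw.
apply: (can_inj (mulKmx hu)); rewrite mulmxV //.
by rewrite -mulmxA [w' *m _]mulmxA mulmxV // mul1mx mulmxV.
Qed.

Lemma weylV w : weyl Phi w -> weyl Phi (invmx w).
Proof.
elim=> {w} [|a w ha hw IH]; first by rewrite invmx1; apply: refl_group1.
rewrite invmxM ?invmx_refl ?weyl_unit //; last exact: weyl_refl.
by apply: weylM => //; apply: weyl_refl.
Qed.

Definition simple_mx : 'M[R]_n := \matrix_(p, j) al j p 0.

Lemma coweight_simple_mx : \matrix_(i < n) om i *m simple_mx = 1%:M.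
Proof.
apply/matrixP => i j; have := coweightE Phi i j.
rewrite !mxE => <-; apply: eq_bigr => p _; by rewrite !mxE.
Qed.

Lemma simple_mxK : simple_mx *m \matrix_(i < n) om i = 1%:M.
Proof. exact: mulmx1C coweight_simple_mx. Qed.

Lemma simple_expand v : v = \sum_i pairing (om i) v *: al i.
Proof.
rewrite -[LHS]mul1mx -simple_mxK -mulmxA.
apply/colP => p; rewrite !mxE summxE; apply: eq_bigr => i _; rewrite !mxE mulrC.
by congr (_ * _); rewrite /pairing !mxE; apply: eq_bigr => r _; rewrite !mxE.
Qed.

Lemma coweight_inj v : (forall i, pairing (om i) v = 0) -> v = 0.
Proof. by move=> h; rewrite (simple_expand v) big1 // => i _; rewrite h scale0r. Qed.

Lemma coweight_simple i j : pairing (om i) (al j) = (i == j)%:R.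
Proof. exact: coweightE. Qed.

Lemma coweight_expand_sum (c : 'I_n -> R) i :
  pairing (om i) (\sum_j c j *: al j) = c i.
Proof.
rewrite pairing_sumr (bigD1 i) //= pairingZr coweight_simple eqxx mulr1.
by rewrite big1 ?addr0 // => j /negPf hj; rewrite pairingZr coweight_simple eq_sym hj mulr0.
Qed.

Definition pos v := forall i, 0 <= pairing (om i) v.

Lemma root_posVneg b : b \in roots -> pos b \/ pos (- b).
Proof.
move=> hb; have [c -> [hc|hc]] := root_pos_neg hb; [left|right] => i.
  by rewrite coweight_expand_sum.
by rewrite pairingNr coweight_expand_sum oppr_ge0.
Qed.

Lemma pos_simple i : pos (al i).
Proof. by move=> j; rewrite coweight_simple ler0n. Qed.

Lemma pos_opp0 v : pos v -> pos (- v) -> v = 0.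
Proof.
move=> h1 h2; apply: coweight_inj => i; apply/eqP; rewrite eq_le h1 andbT.
by rewrite -oppr_ge0 -pairingNr.
Qed.

Lemma root0 b : b \in roots -> b != 0.
Proof. by move=> hb; apply: contraTneq hb => ->; apply: root_neq0. Qed.

Lemma simple_neq0 i : al i != 0.
Proof. exact: root0 (simple_root Phi i). Qed.

Lemma pos_oppP b : b \in roots -> ~ pos b <-> pos (- b).
Proof.
move=> hb; split; first by case: (root_posVneg hb).
by move=> h1 h2; have := root0 hb; rewrite (pos_opp0 h2 h1) eqxx.
Qed.

(** An element of the group permutes the roots and is determined by the images of the simple roots,
    so it is given by a function from indices to the finite list [roots]. *)
Lemma weyl_finite : exists r : seq 'M[R]_n,
  uniq r /\ forall w, weyl Phi w <-> w \in r.
Proof.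
pose mk (f : {ffun 'I_n -> 'I_(size roots)}) : 'M[R]_n :=
  (\matrix_(p, j) nth 0 roots (f j) p 0) *m \matrix_(i < n) om i.
exists (undup [seq w <- map mk (enum {ffun 'I_n -> 'I_(size roots)}) | `[< weyl Phi w >]]).
split; first exact: undup_uniq.
move=> w; rewrite mem_undup mem_filter; split; last by case/andP => /asboolP.
move=> hw; apply/andP; split; first exact/asboolP.
have hr j : w *m al j \in roots by apply: weyl_root => //; apply: simple_root.
apply/mapP; exists [ffun j => Ordinal (etrans (index_mem _ _) (hr j))].
  by rewrite mem_enum.
rewrite /mk -[LHS]mulmx1 -simple_mxK mulmxA; congr (_ *m _).
apply/matrixP => p j; rewrite !mxE ffunE /= nth_index // mxE.
by apply: eq_bigr => k _; rewrite !mxE.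
Qed.

Definition weyl_enum : seq 'M[R]_n := projT1 (cid weyl_finite).

Lemma weyl_enum_uniq : uniq weyl_enum.
Proof. by rewrite /weyl_enum; case: cid => r []. Qed.

Lemma weyl_enumP w : weyl Phi w <-> w \in weyl_enum.
Proof. by rewrite /weyl_enum; case: cid => r []. Qed.

(** An inner product invariant under the reflection group, by averaging. *)
Definition inner_mx : 'M[R]_n := \sum_(w <- weyl_enum) w^T *m w.
Definition inner u v : R := pairing (u^T *m inner_mx) v.

Lemma inner_sum u v :
  inner u v = \sum_(w <- weyl_enum) pairing (w *m u)^T (w *m v).
Proof.
rewrite /inner pairingM /inner_mx mulmx_suml pairing_sumr.
by apply: eq_bigr => w _; rewrite trmx_mul pairingM mulmxA.
Qed.

Lemma inner_sym u v : inner u v = inner v u.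
Proof.
rewrite !inner_sum; apply: eq_bigr => w _; rewrite !pairing_trl.
by apply: eq_bigr => k _; rewrite mulrC.
Qed.

Lemma inner_weyl w u v : weyl Phi w -> inner (w *m u) (w *m v) = inner u v.
Proof.
move=> hw; rewrite !inner_sum.
have hu := weyl_unit hw.
transitivity (\sum_(x <- [seq x *m w | x <- weyl_enum]) pairing (x *m u)^T (x *m v)).
  by rewrite big_map; apply: eq_bigr => x _; rewrite !mulmxA.
apply: perm_big; apply: uniq_perm; last 1 first.
- move=> x; apply/idP/idP.
    by case/mapP => y /weyl_enumP hy ->; apply/weyl_enumP/weylM.
  move=> /weyl_enumP hx; apply/mapP; exists (x *m invmx w); last by rewrite mulmxKV.
  by apply/weyl_enumP/weylM => //; apply: weylV.
- by rewrite map_inj_uniq ?weyl_enum_uniq //; apply: (can_inj (mulmxK hu)).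
- exact: weyl_enum_uniq.
Qed.

Lemma inner_ge0 u : 0 <= inner u u.
Proof.
rewrite inner_sum sumr_ge0 // => w _; rewrite pairing_trl sumr_ge0 // => i _.
by rewrite -expr2 sqr_ge0.
Qed.

Lemma inner_eq0 u : inner u u = 0 -> u = 0.
Proof.
move=> /eqP; rewrite inner_sum psumr_eq0; last first.
  move=> w _; rewrite pairing_trl sumr_ge0 // => i _.
  by rewrite -expr2 sqr_ge0.
have h1 : 1%:M \in weyl_enum by apply/weyl_enumP; apply: refl_group1.
move=> /allP /(_ _ h1); rewrite /= mul1mx pairing_trl psumr_eq0; last first.
  by move=> i _; rewrite -expr2 sqr_ge0.
move=> /allP h; apply/colP => i; have := h i (mem_index_enum i).
by rewrite /= -expr2 sqrf_eq0 => /eqP ->; rewrite mxE.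
Qed.

Lemma inner_gt0 u : u != 0 -> 0 < inner u u.
Proof.
move=> u0; rewrite lt_def inner_ge0 andbT.
by apply: contra u0 => /eqP /inner_eq0 ->.
Qed.

Lemma innerDr u v v' : inner u (v + v') = inner u v + inner u v'.
Proof. exact: pairingDr. Qed.
Lemma innerNr u v : inner u (- v) = - inner u v.
Proof. exact: pairingNr. Qed.
Lemma innerZr u c v : inner u (c *: v) = c * inner u v.
Proof. exact: pairingZr. Qed.
Lemma innerZl u c v : inner (c *: u) v = c * inner u v.
Proof. by rewrite inner_sym innerZr inner_sym. Qed.
Lemma innerNl u v : inner (- u) v = - inner u v.
Proof. by rewrite inner_sym innerNr inner_sym. Qed.
Lemma innerDl u u' v : inner (u + u') v = inner u v + inner u' v.
Proof. by rewrite inner_sym innerDr !(inner_sym v). Qed.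
Lemma inner_sumr I (r : seq I) (P : pred I) u (F : I -> 'cV[R]_n) :
  inner u (\sum_(i <- r | P i) F i) = \sum_(i <- r | P i) inner u (F i).
Proof. exact: pairing_sumr. Qed.
Lemma inner_suml I (r : seq I) (P : pred I) (F : I -> 'cV[R]_n) v :
  inner (\sum_(i <- r | P i) F i) v = \sum_(i <- r | P i) inner (F i) v.
Proof. by rewrite inner_sym inner_sumr; apply: eq_bigr => i _; rewrite inner_sym. Qed.

(** Invariance of [inner] under the reflection in [a] forces the coroot to be 2 (a, -) / (a, a).
    Compatibility of coroots with the group, [coroot_weyl], follows from this formula. *)
Lemma coroot_inner a v : a \in roots ->
  inner a a * pairing (coroot Phi a) v = 2 * inner a v.
Proof.
move=> ha; have := inner_weyl a v (weyl_refl ha).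
rewrite !reflE innerDr innerNr innerZr innerDl innerNl innerZl innerDl innerNl innerZl.
rewrite [pairing _ a](coroot2 ha).
move: (pairing _ _) (inner _ _) (inner _ _) => c x y; lra.
Qed.

Lemma coroot_weyl w a v : weyl Phi w -> a \in roots ->
  pairing (coroot Phi (w *m a)) (w *m v) = pairing (coroot Phi a) v.
Proof.
move=> hw ha; apply: (mulfI (lt0r_neq0 (inner_gt0 (root0 ha)))).
rewrite coroot_inner // -[in LHS](inner_weyl a a hw).
by rewrite (coroot_inner _ (weyl_root hw ha)) inner_weyl.
Qed.

Lemma refl_weyl w a : weyl Phi w -> a \in roots ->
  refl Phi (w *m a) *m w = w *m refl Phi a.
Proof.
move=> hw ha; apply: mulmx_ext => v.
by rewrite -!mulmxA !reflE coroot_weyl // mulmxBr -scalemxAr.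
Qed.

(** The reflection changes only the coefficient of [al i]; if the sign flips, all other coefficients
    of [b] vanish, and reducedness leaves only [al i]. *)
Lemma simple_perm_pos i b : b \in roots -> pos b -> ~ pos (s i *m b) -> b = al i.
Proof.
move=> hb pb /(pos_oppP (refl_root (simple_root Phi i) hb)) nb.
have h0 j : j != i -> pairing (om j) b = 0.
  move=> /negPf ji; apply/eqP; rewrite eq_le pb andbT -oppr_ge0.
  have := nb j; rewrite pairingNr refl_simpleE pairingBr pairingZr coweight_simple.
  by rewrite ji mulr0 subr0.
have eb : b = pairing (om i) b *: al i.
  rewrite {1}(simple_expand b) (bigD1 i) //= big1 ?addr0 // => j ji.
  by rewrite h0 // scale0r.
have [h|h] : pairing (om i) b = 1 \/ pairing (om i) b = -1.
- by apply: (root_reduced (simple_root Phi i)); rewrite -eb.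
- by rewrite eb h scale1r.
- by have := pb i; rewrite h oppr_ge0 ler10.
Qed.

(** * Words in the simple reflections, exchange, and shortest coset elements *)

Definition wmx q : 'M[R]_n := foldr (fun i w => s i *m w) 1%:M q.

Lemma wmx_cat q q' : wmx (q ++ q') = wmx q *m wmx q'.
Proof. by elim: q => [|i q IH] /=; rewrite ?mul1mx // IH mulmxA. Qed.

Lemma weyl_wmx q : weyl Phi (wmx q).
Proof.
elim: q => [|i q IH] /=; first exact: refl_group1.
by apply: weylM => //; apply: weyl_simple.
Qed.

(** Exchange condition for arbitrary, possibly unreduced, words: reading the word from the left, the
    first letter that makes [b] negative meets it as a simple root, and the reflection cancels that
    letter. *)
Lemma wmx_exchange q b : b \in roots -> pos b -> ~ pos (invmx (wmx q) *m b) ->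
  exists2 q', (size q' < size q)%N & refl Phi b *m wmx q = wmx q'.
Proof.
elim: q b => [|j q IH] b hb pb /=; first by rewrite invmx1 mul1mx.
rewrite invmxM ?(weyl_unit (weyl_simple _)) ?(weyl_unit (weyl_wmx _)) //.
rewrite invmx_refl ?simple_root // -mulmxA.
have hsb := refl_root (simple_root Phi j) hb.
have [ps|/(simple_perm_pos hb pb) ->] := pselect (pos (s j *m b)).
  move=> /(IH _ hsb ps) [q' sq' eq']; exists (j :: q') => //=.
  by rewrite -eq' !mulmxA -(refl_weyl (weyl_simple j) hsb) mulmxA refl_simpleK mul1mx.
by move=> _; exists q => //; rewrite mulmxA refl_simpleK mul1mx.
Qed.

Definition height v := \sum_i pairing (om i) v.

Lemma refl_opp a : a \in roots -> refl Phi (- a) = refl Phi a.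
Proof.
move=> ha; have := refl_weyl (weyl_refl ha) ha.
rewrite {1}reflE [pairing _ a](coroot2 ha) scaler_nat mulr2n opprD addrA subrr sub0r.
move=> /(congr1 (fun A => A *m refl Phi a)); rewrite -!mulmxA refl_invol //.
by rewrite !mulmx1.
Qed.

Lemma count_lt (T : eqType) (P Q : pred T) (r : seq T) x :
  (forall y, P y -> Q y) -> x \in r -> Q x -> ~~ P x -> (count P r < count Q r)%N.
Proof.
move=> PQ xr Qx Px; rewrite -(size_filter Q) -(count_predC P [seq y <- r | Q y]).
rewrite count_filter (_ : count (predI P Q) r = count P r); last first.
  by apply: eq_count => y /=; case h: (P y) => //=; rewrite PQ.
rewrite -[X in (X < _)%N]addn0 ltn_add2l -has_count; apply/hasP; exists x => //.
by rewrite mem_filter Qx.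
Qed.

(** As (b, b) > 0, some simple root has positive inner product with [b]. Reflecting in it lowers the
    height, keeps [b] positive unless [b] is that simple root, and conjugates the reflections. *)
Lemma refl_word b : b \in roots -> pos b -> exists q, refl Phi b = wmx q.
Proof.
(* Heights are real numbers here, so the induction runs on the number of roots of smaller height. *)
pose m b := count (fun g => height g < height b) roots.
have [k] := ubnP (m b); elim: k b => // k IH b hk hb pb.
have [i hi] : exists i, 0 < inner (al i) b.
  apply: contrapT => /forallNP h; have := inner_gt0 (root0 hb).
  rewrite {1}(simple_expand b) inner_suml ltNge sumr_le0 // => i _.
  by rewrite innerZl mulr_ge0_le0 // leNgt; apply/negP.
have [->|bi] := pselect (b = al i); first by exists [:: i]; rewrite /= mulmx1.
have pg : pos (s i *m b) by apply: contrapT => /(simple_perm_pos hb pb).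
have hg := refl_root (simple_root Phi i) hb.
have c0 : 0 < pairing (cor i) b.
  rewrite -(pmulr_rgt0 _ (inner_gt0 (simple_neq0 i))).
  by rewrite (coroot_inner _ (simple_root Phi i)) mulr_gt0.
have hlt : height (s i *m b) < height b.
  rewrite /height refl_simpleE; under eq_bigr do rewrite pairingBr pairingZr.
  rewrite sumrB gtrBl (bigD1 i) //= coweight_simple eqxx mulr1 big1 ?addr0 // => j.
  by move=> /negPf ji; rewrite coweight_simple ji mulr0.
have [|q eq] := IH _ _ hg pg.
  apply: (@leq_trans (m b)) => //; apply: (count_lt (x := s i *m b)) => //; last by rewrite ltxx.
  by move=> y /lt_trans; apply.
exists (i :: q ++ [:: i]); rewrite /= wmx_cat /= mulmx1 -eq.
rewrite mulmxA -(refl_weyl (weyl_simple i) hg) -mulmxA refl_simpleK mulmx1.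
by rewrite mulmxA refl_simpleK mul1mx.
Qed.

Lemma weyl_word w : weyl Phi w -> exists q, w = wmx q.
Proof.
elim=> {w} [|a w ha _ [q ->]]; first by exists [::].
have [q' ->] : exists q', refl Phi a = wmx q'.
  have [pa|pa] := root_posVneg ha; first exact: refl_word.
  by rewrite -refl_opp //; apply: refl_word => //; apply: root_opp.
by exists (q' ++ q); rewrite wmx_cat.
Qed.

Lemma weyl_parab_word (J : {set 'I_n}) w : weyl_parab Phi J w ->
  exists2 q, all (mem J) q & w = wmx q.
Proof.
elim=> {w} [|_ w [i iJ ->] _ [q hq ->]]; first by exists [::].
by exists (i :: q); rewrite //= iJ.
Qed.

Lemma weyl_parab_wmx (J : {set 'I_n}) q : all (mem J) q -> weyl_parab Phi J (wmx q).
Proof.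
elim: q => [_|i q IH /= /andP [iJ /IH hq]]; first exact: refl_group1.
by apply: refl_groupM => //; exists i.
Qed.

Lemma weyl_parabW (J : {set 'I_n}) w : weyl_parab Phi J w -> weyl Phi w.
Proof. by move=> /weyl_parab_word [q _ ->]; apply: weyl_wmx. Qed.

Lemma invmx_wmx q : invmx (wmx q) = wmx (rev q).
Proof.
elim: q => [|i q IH] /=; first by rewrite invmx1.
rewrite invmxM ?(weyl_unit (weyl_simple _)) ?(weyl_unit (weyl_wmx _)) //.
by rewrite invmx_refl ?simple_root // IH rev_cons -cats1 wmx_cat /= mulmx1.
Qed.

Lemma weyl_parabV (J : {set 'I_n}) w : weyl_parab Phi J w -> weyl_parab Phi J (invmx w).
Proof.
move=> /weyl_parab_word [q hq ->]; rewrite invmx_wmx.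
by apply: weyl_parab_wmx; rewrite all_rev.
Qed.

Lemma weyl_parabM (J : {set 'I_n}) w w' :
  weyl_parab Phi J w -> weyl_parab Phi J w' -> weyl_parab Phi J (w *m w').
Proof.
move=> /weyl_parab_word [q hq ->] /weyl_parab_word [q' hq' ->]; rewrite -wmx_cat.
by apply: weyl_parab_wmx; rewrite all_cat hq.
Qed.

Lemma simple_refl_conj w i j : weyl Phi w -> w *m al j = al i -> s i *m w = w *m s j.
Proof. by move=> hw <-; apply: refl_weyl => //; apply: simple_root. Qed.

(** [w] is the shortest element of [w W_J]. *)
Definition coset_min (J : {set 'I_n}) w :=
  weyl Phi w /\ forall j, j \in J -> pos (w *m al j).

Lemma coset_min1 J : coset_min J 1%:M.
Proof. by split=> [|j _]; [exact: refl_group1 | rewrite mul1mx; exact: pos_simple]. Qed.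

(** If [s i] turns some positive [w *m al j] negative, then [w *m al j = al i], which conjugates
    [s j] into [s i]. *)
Lemma coset_min_simple J w i : coset_min J w -> ~ coset_min J (s i *m w) ->
  exists2 j, j \in J & s i *m w = w *m s j.
Proof.
case=> hw pw hn; apply: contrapT => hc; apply: hn; split.
  by apply: weylM => //; apply: weyl_simple.
move=> j jJ; apply: contrapT; rewrite -mulmxA => hn; apply: hc; exists j => //.
apply: simple_refl_conj => //; apply: simple_perm_pos hn; last exact: pw.
by apply: weyl_root => //; apply: simple_root.
Qed.

(** Here [s i] turns a negative [wmx q *m al j] positive, so this root is [- al i] and exchange
    applies. It lets inductions over words avoid tails that are not shortest in their coset. *)
Lemma coset_min_pred J q i : coset_min J (s i *m wmx q) -> ~ coset_min J (wmx q) ->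
  exists2 q', (size q' < size q)%N & s i *m wmx q = wmx q'.
Proof.
move=> [hw pw] hn.
have [j jJ hj] : exists2 j, j \in J & ~ pos (wmx q *m al j).
  apply: contrapT => h; apply: hn; split; first exact: weyl_wmx.
  by move=> j jJ; apply: contrapT => hj; apply: h; exists j.
apply: wmx_exchange; rewrite ?simple_root //; first exact: pos_simple.
have hr := weyl_root (weyl_wmx q) (simple_root Phi j).
move/(pos_oppP hr) in hj.
have : - (wmx q *m al j) = al i.
  apply: (simple_perm_pos (i := i)) => //; first exact: root_opp.
  have hr' := root_opp (weyl_root hw (simple_root Phi j)).
  by rewrite mulmxN mulmxA; apply/(pos_oppP hr'); rewrite opprK; apply: pw.
move=> <-; rewrite mulmxN mulKmx ?weyl_unit //; last exact: weyl_wmx.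
apply/(pos_oppP (root_opp (simple_root Phi j))).
by rewrite opprK; exact: pos_simple.
Qed.

(** * Fundamental weights and the dominance order *)

Definition coroot_mx : 'M[R]_n := \matrix_(i < n) cor i.

Lemma simple_inner i v : inner (al i) (al i) * pairing (cor i) v = 2 * inner (al i) v.
Proof. exact: coroot_inner (simple_root Phi i). Qed.

(** A vector killed by all simple coroots is orthogonal to all simple roots, hence to itself. *)
Lemma coroot_mx_unit : coroot_mx \in unitmx.
Proof.
rewrite unitmxE unitfE -det_tr; apply/negP => /det0P [v v0 hv].
have h i : pairing (cor i) v^T = 0.
  have /rowP /(_ i) := hv; rewrite !mxE => <-; rewrite /pairing mxE.
  by apply: eq_bigr => p _; rewrite !mxE mulrC.
suff : v^T = 0 by move=> /(congr1 trmx); rewrite trmxK trmx0 => v0'; rewrite v0' eqxx in v0.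
apply: inner_eq0; rewrite {1}(simple_expand v^T) inner_suml big1 // => i _.
have := simple_inner i v^T; rewrite h mulr0 innerZl => /esym/eqP.
by rewrite mulf_eq0 pnatr_eq0 /= => /eqP ->; rewrite mulr0.
Qed.

(** The fundamental weights, the basis dual to the simple coroots. They have two uses: they test the
    dominance order, and those outside [J] give central elements of the parabolic subalgebra. *)
Definition fweight i : 'cV[R]_n := col i (invmx coroot_mx).

Lemma scoroot_fweight i j : pairing (cor i) (fweight j) = (i == j)%:R.
Proof.
rewrite /pairing /fweight -[cor i](rowK cor) -/coroot_mx.
rewrite colE mulmxA -row_mul mulmxV ?coroot_mx_unit // -[_ *m _]colE.
by rewrite !mxE.
Qed.

Lemma scoroot_expand (g : 'rV[R]_n) : g = \sum_i pairing g (fweight i) *: cor i.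
Proof.
rewrite -[LHS](mulmxKV coroot_mx_unit) [LHS]mulmx_sum_row; apply: eq_bigr => i _.
by rewrite rowK /pairing /fweight colE mulmxA -colE [in RHS]mxE.
Qed.

Lemma scoroot_sum_fweight (c : 'I_n -> R) i :
  pairing (\sum_j c j *: cor j) (fweight i) = c i.
Proof.
rewrite pairing_suml (bigD1 i) //= pairingZl scoroot_fweight eqxx mulr1.
by rewrite big1 ?addr0 // => j /negPf hj; rewrite pairingZl scoroot_fweight hj mulr0.
Qed.

Lemma dominanceP g1 g2 : dominance_le Phi g1 g2 <->
  forall i, pairing g1 (fweight i) <= pairing g2 (fweight i).
Proof.
split=> [[a a0 e] i|h].
  by rewrite -subr_ge0 -pairingBl e scoroot_sum_fweight.
exists (fun i => pairing (g2 - g1) (fweight i)); last exact: scoroot_expand.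
by move=> i; rewrite pairingBl subr_ge0.
Qed.

(** The coroot is a positive multiple of (b, -), and every (al j, fweight i) is nonnegative. *)
Lemma pos_coroot b i : b \in roots -> pos b -> 0 <= pairing (coroot Phi b) (fweight i).
Proof.
move=> hb pb; rewrite -(pmulr_rge0 _ (inner_gt0 (root0 hb))) coroot_inner //.
rewrite mulr_ge0 // (simple_expand b) inner_suml sumr_ge0 // => j _.
rewrite innerZl mulr_ge0 //.
have := simple_inner j (fweight i); rewrite scoroot_fweight => h.
by rewrite -(pmulr_rge0 _ (_ : 0 < 2)) // -h mulr_ge0 ?ler0n // inner_ge0.
Qed.

(** Otherwise the root [s i *m al j] would have coefficients of both signs. *)
Lemma simple_inner_le0 i j : i != j -> inner (al i) (al j) <= 0.
Proof.
move=> ij; rewrite -(pmulr_rle0 _ (_ : 0 < 2)) // -simple_inner.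
rewrite pmulr_rle0 ?inner_gt0 ?simple_neq0 // leNgt; apply/negP => h.
have hr := refl_root (simple_root Phi i) (simple_root Phi j).
have [p|p] := root_posVneg hr.
  have := p i; rewrite refl_simpleE pairingBr pairingZr !coweight_simple eqxx.
  by rewrite (negPf ij) mulr1 sub0r oppr_ge0 leNgt h.
have := p j; rewrite pairingNr refl_simpleE pairingBr pairingZr !coweight_simple eqxx.
by rewrite eq_sym (negPf ij) mulr0 subr0 oppr_ge0 lern0.
Qed.

(** Induction on a word for [w]: a further letter [i] either subtracts the multiple [g (w^-1 al i)]
    of a simple coroot, nonnegative when [w^-1 al i] is positive, or can be traded by exchange for a
    shorter word. *)
Lemma dominant_weyl_le (g : 'rV[R]_n) w : weyl Phi w ->
  (forall i, 0 <= pairing g (al i)) -> dominance_le Phi (g *m invmx w) g.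
Proof.
move=> /weyl_word [q ->] hg; apply/dominanceP => k.
have gpos b : pos b -> 0 <= pairing g b.
  move=> pb; rewrite (simple_expand b) pairing_sumr sumr_ge0 // => i _.
  by rewrite pairingZr mulr_ge0.
have [m] := ubnP (size q); elim: m q => // m IH [_|i q /= hq].
  by rewrite /= invmx1 mulmx1.
have [p|p] := pselect (pos (invmx (wmx q) *m al i)); last first.
  have [q' sq' ->] := wmx_exchange (simple_root Phi i) (@pos_simple i) p.
  by apply: IH; apply: leq_trans sq' (ltnW hq).
apply: le_trans (IH q hq).
rewrite invmxM ?(weyl_unit (weyl_simple _)) ?(weyl_unit (weyl_wmx _)) //.
rewrite invmx_refl ?simple_root // mulmxA pairingM refl_simpleE.
rewrite pairingBr pairingZr gerBl mulr_ge0 //.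
  by rewrite scoroot_fweight ler0n.
by rewrite pairingM gpos.
Qed.

Lemma scoroot_invmx w i v : weyl Phi w ->
  pairing (cor i *m invmx w) v = pairing (coroot Phi (w *m al i)) v.
Proof.
move=> hw; rewrite pairingM -[in RHS](mulKVmx (weyl_unit hw) v) coroot_weyl //.
exact: simple_root.
Qed.

(** A shortest [w] maps the simple coroots of [J] to positive coroots, so the [a]-part remains below
    0; the [b]-part is dominant and decreases under [w]. *)
Lemma langlands_weyl_le (J : {set 'I_n}) g (a b : 'I_n -> R) w : langlands_decomp Phi J g a b ->
  coset_min J w ->
  dominance_le Phi (g *m invmx w) (\sum_(i | i \notin J) b i *: om i).
Proof.
move=> [ha hb ->] [hw pw]; set nu := (X in dominance_le _ _ X).
apply/dominanceP => k; rewrite mulmxDl pairingDl -[leRHS]add0r lerD //.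
  rewrite mulmx_suml pairing_suml sumr_le0 // => j jJ.
  rewrite -scalemxAl pairingZl mulr_le0_ge0 ?ha // scoroot_invmx //.
  by apply: pos_coroot; [apply: weyl_root => //; exact: simple_root | exact: pw].
move: k; apply/dominanceP; apply: dominant_weyl_le => // i.
rewrite /nu pairing_suml sumr_ge0 // => j jJ.
by rewrite pairingZl mulr_ge0 ?(ltW (hb _ jJ)) // coweight_simple ler0n.
Qed.

(** The inverse of a Cartan matrix is nonnegative, as the inner product is
    nonpositive on distinct simple roots. *)
Lemma partial_dominance (J : {set 'I_n}) (g : 'rV[R]_n) :
  (forall i, i \notin J -> 0 <= pairing g (fweight i)) ->
  (forall i, i \in J -> 0 <= pairing g (al i)) ->
  forall i, 0 <= pairing g (fweight i).
Proof.
move=> hJ hp.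
(* The coefficients of [g] on the simple roots once the dual space is identified with the space
   through [inner]. *)
pose c i := 2 * pairing g (fweight i) / inner (al i) (al i).
have gE v : pairing g v = inner (\sum_i c i *: al i) v.
  rewrite {1}(scoroot_expand g) pairing_suml inner_suml; apply: eq_bigr => i _.
  rewrite pairingZl innerZl /c; have := simple_inner i v.
  have := lt0r_neq0 (inner_gt0 (simple_neq0 i)).
  move: (inner _ _) (inner _ _) (pairing _ _) (pairing _ _) => x y z t x0 h.
  by apply: (mulfI x0); rewrite mulrCA h; field.
have c_ge0 i : (0 <= c i) = (0 <= pairing g (fweight i)).
  by rewrite /c pmulr_lge0 ?invr_gt0 ?inner_gt0 ?simple_neq0 // pmulr_rge0.
(* [P] and [N] are the positive and negative parts of [c], and [N] vanishes outside [J]. With [Z]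
   the combination given by [N], 0 <= g(Z) = (P, Z) - (Z, Z), and (P, Z) <= 0 because the supports
   are disjoint; so Z = 0. *)
pose N i := if 0 <= c i then 0 else - c i.
pose P i := if 0 <= c i then c i else 0.
have N0 i : 0 <= N i.
  by rewrite /N; case: (leP 0 (c i)) => [_|/ltW h]; rewrite ?lexx // oppr_ge0.
have P0 i : 0 <= P i by rewrite /P; case: (leP 0 (c i)) => // _; rewrite lexx.
have cE i : c i = P i - N i by rewrite /P /N; case: (leP 0 (c i)); rewrite ?subr0 ?opprK ?add0r.
pose Z := \sum_i N i *: al i.
have : 0 <= pairing g Z.
  rewrite /Z pairing_sumr sumr_ge0 // => i _; rewrite pairingZr.
  have [iJ|iJ] := boolP (i \in J); first by rewrite mulr_ge0 ?hp.
  by rewrite /N c_ge0 hJ // mul0r.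
have -> : pairing g Z = inner (\sum_i P i *: al i) Z - inner Z Z.
  rewrite gE -innerNl -innerDl; congr (inner _ _).
  by rewrite /Z -sumrN -big_split /=; apply: eq_bigr => i _; rewrite cE scalerBl.
have hPZ : inner (\sum_i P i *: al i) Z <= 0.
  rewrite inner_suml sumr_le0 // => i _; rewrite /Z inner_sumr sumr_le0 // => j _.
  rewrite innerZl innerZr; have [<-|ij] := eqVneq i j.
    by rewrite /P /N; case: (leP 0 (c i)) => _; rewrite ?mul0r ?mulr0.
  by rewrite mulr_ge0_le0 // mulr_ge0_le0 // simple_inner_le0.
move=> h; have Z0 : Z = 0.
  apply: inner_eq0; apply/eqP; rewrite eq_le inner_ge0 andbT.
  by move: h; rewrite subr_ge0 => /le_trans; apply.
move=> i; rewrite -c_ge0; have := coweight_expand_sum N i.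
by rewrite -/Z Z0 pairing0r /N; case: (leP 0 (c i)) => // h1 /esym/eqP; rewrite oppr_eq0 => /eqP h2; rewrite h2 ltxx in h1.
Qed.

Section Decompositions.
Variables (J : {set 'I_n}) (a b : 'I_n -> R) (g : 'rV[R]_n).
Hypothesis gab : langlands_decomp Phi J g a b.
Local Notation nug := (\sum_(i | i \notin J) b i *: om i).

Lemma langlands_nu_dominant i : 0 <= pairing nug (al i).
Proof.
case: gab => _ hb _; rewrite pairing_suml sumr_ge0 // => j jJ.
by rewrite pairingZl mulr_ge0 ?(ltW (hb _ jJ)) // coweight_simple ler0n.
Qed.

Lemma langlands_nu_simple i : i \in J -> pairing nug (al i) = 0.
Proof.
move=> iJ; rewrite pairing_suml big1 // => j jJ; rewrite pairingZl coweight_simple.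
by rewrite (_ : j == i = false) ?mulr0 //; apply: contraNF jJ => /eqP ->.
Qed.

Lemma langlands_nu_fweight i : i \notin J -> pairing nug (fweight i) = pairing g (fweight i).
Proof.
case: gab => _ _ ->; move: nug => N iJ.
rewrite pairingDl pairing_suml big1 ?add0r // => j jJ.
rewrite pairingZl scoroot_fweight (_ : j == i = false) ?mulr0 //.
by apply: contraNF iJ => /eqP <-.
Qed.

End Decompositions.

(** Both hypotheses of [partial_dominance] hold for [nu'] minus the [b]-part of [g]: outside [J]
    that part agrees with [g], hence with [g'], on [fweight i]; on simple roots of [J] it vanishes
    while [nu'] is dominant. *)
Lemma langlands_nu_le (J : {set 'I_n}) g (a b : 'I_n -> R) g' (nu' : 'rV[R]_n) :
  langlands_decomp Phi J g a b ->
  (forall i, i \notin J -> pairing g (fweight i) = pairing g' (fweight i)) ->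
  dominance_le Phi g' nu' -> (forall i, 0 <= pairing nu' (al i)) ->
  dominance_le Phi (\sum_(i | i \notin J) b i *: om i) nu'.
Proof.
move=> gab gg' /dominanceP h dom; apply/dominanceP => i; rewrite -subr_ge0 -pairingBl.
move: i; apply: (@partial_dominance J) => i iJ; rewrite pairingBl.
  by rewrite (langlands_nu_fweight gab) // gg' // subr_ge0 h.
by rewrite (langlands_nu_simple b iJ) subr0.
Qed.

(** The preceding lemma in both directions, each [b]-part serving as the dominant bound for the
    other. *)
Lemma langlands_nu_unique (J : {set 'I_n}) g (a b : 'I_n -> R) g' (a' b' : 'I_n -> R) :
  langlands_decomp Phi J g a b -> langlands_decomp Phi J g' a' b' ->
  (forall i, i \notin J -> pairing g (fweight i) = pairing g' (fweight i)) ->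
  \sum_(i | i \notin J) b i *: om i = \sum_(i | i \notin J) b' i *: om i.
Proof.
move=> h h' gg'.
have le1 g1 (a1 b1 : 'I_n -> R) g2 (a2 b2 : 'I_n -> R) : langlands_decomp Phi J g1 a1 b1 ->
    langlands_decomp Phi J g2 a2 b2 ->
    (forall i, i \notin J -> pairing g1 (fweight i) = pairing g2 (fweight i)) ->
    forall i, pairing (\sum_(i | i \notin J) b1 i *: om i) (fweight i) <=
      pairing (\sum_(i | i \notin J) b2 i *: om i) (fweight i).
  move=> h1 h2 g12; apply/dominanceP; apply: (langlands_nu_le h1 (g' := \sum_(i | i \notin J) b2 i *: om i)).
  - by move=> i iJ; rewrite g12 // (langlands_nu_fweight h2).
  - exact/dominanceP.
  - exact: langlands_nu_dominant h2.
rewrite [LHS]scoroot_expand [RHS]scoroot_expand; apply: eq_bigr => i _; congr (_ *: _).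
apply/eqP; rewrite eq_le; apply/andP; split; last apply: le1 h' h _ _ => j jJ.
  exact: le1 h h' gg' i.
by rewrite gg'.
Qed.

End RootSystemTheory.

(** * Projective resolutions *)

Section Homological.
Variable A : nzRingType.

Section ProjLift.
Variables (P M N : lmodType A) (g : {linear M -> N}) (f : {linear P -> N}).

Definition pullback_map (z : M * P) : N := g z.1 - f z.2.

Fact pullback_map_linear : linear pullback_map.
Proof.
move=> c [m p] [m' p']; rewrite /pullback_map /= !linearP.
by rewrite scalerBr /= scalerN addrACA.
Qed.

HB.instance Definition _ := GRing.isLinear.Build A (M * P)%type N *:%R pullback_map
  pullback_map_linear.

(** [projective] speaks of surjections only. When the image of [f] lies in that of [g], the fibre
    product of [g] and [f] surjects onto [P]; a section followed by the projection to [M] is the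
    lift. *)
Lemma projective_lift : projective P -> (forall x, exists m, g m = f x) ->
  exists h : {linear P -> M}, forall x, g (h x) = f x.
Proof.
move=> hP hgf; pose incl := ker_incl pullback_map.
have [|h hh] := hP _ _ (snd \o incl)%FUN idfun.
  move=> p; have [m gm] := hgf p.
  have h0 : pullback_map (m, p) == 0 by rewrite /pullback_map /= gm subrr.
  by exists (KerMod h0).
exists (fst \o incl \o h)%FUN => x /=.
have /eqP := ker_valP (h x); rewrite /pullback_map => /eqP; rewrite subr_eq0 => /eqP ->.
by congr (f _); apply: hh.
Qed.

End ProjLift.

Lemma nat_dep_choice (T : nat -> Type) (S : forall i, T i -> T i.+1 -> Prop) (x0 : T 0%N) :
  (forall i x, exists y, @S i x y) -> exists F : forall i, T i,
    F 0%N = x0 /\ forall i, S i (F i) (F i.+1).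
Proof.
move=> h; exists (nat_rect T x0 (fun i x => projT1 (cid (h i x)))).
by split=> // i /=; apply: (projT2 (cid (h i _))).
Qed.

Section Resolutions.
Variables (M M' : lmodType A) (P : proj_resolution M) (P' : proj_resolution M').

Definition chain_map (F : forall i, {linear P i -> P' i}) :=
  forall i x, F i (pres_d P i x) = pres_d P' i (F i.+1 x).

(** Cycles, with the augmentation as differential out of degree 0, so that both exactness fields
    read alike. *)
Definition pres_bd (M : lmodType A) (P : proj_resolution M) i : P i -> Prop :=
  match i with
  | 0%N => fun x => pres_aug P x = 0
  | j.+1 => fun x => pres_d P j x = 0
  end.

Lemma pres_bdP (M0 : lmodType A) (P0 : proj_resolution M0) i (x : P0 i) : pres_bd x <-> exists y, pres_d P0 i y = x.
Proof. by case: i x => [|i] x; [apply: pres_exact0 | apply: pres_exact]. Qed.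

Lemma chain_lift (f : {linear M -> M'}) :
  exists F : forall i, {linear P i -> P' i},
    (forall x, pres_aug P' (F 0%N x) = f (pres_aug P x)) /\ chain_map F.
Proof.
(* Each map is carried with the property that makes the next lift possible: boundaries go to
   cycles. *)
pose T i := {F : {linear P i -> P' i} | forall y, pres_bd (F (pres_d P i y))}.
have [F0 hF0] : exists F0 : {linear P 0%N -> P' 0%N},
    forall x, pres_aug P' (F0 x) = f (pres_aug P x).
  apply: (projective_lift (f := (f \o pres_aug P)%FUN)); first exact: pres_proj.
  by move=> x; apply: pres_aug_surj.
have b0 y : pres_bd (F0 (pres_d P 0%N y)).
  by rewrite /= hF0 (_ : pres_aug P _ = 0) ?linear0 //; apply/pres_exact0; exists y.
pose S i (F : T i) (G : T i.+1) :=
  forall x, sval F (pres_d P i x) = pres_d P' i (sval G x).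
have [i [F hF]|F [e0 hF]] := @nat_dep_choice T S (exist _ F0 b0).
  have [|G hG] := projective_lift (g := pres_d P' i)
    (f := (F \o pres_d P i)%FUN) (@pres_proj _ _ P i.+1).
    by move=> x; apply/pres_bdP/hF.
  have bG y : pres_bd (G (pres_d P i.+1 y)).
    rewrite /= hG /= (_ : pres_d P i _ = 0) ?linear0 //.
    by apply/pres_exact; exists y.
  by exists (exist _ G bG) => x; rewrite /= hG.
exists (fun i => sval (F i)); split; last exact: hF.
by move=> x; rewrite e0 /= hF0.
Qed.

(** A lift of the zero map is null-homotopic. The first conjunct drives the induction: it says that
    [F i.+1 - h d] lands in the cycles. The second is the homotopy formula in degree [i]. *)
Lemma chain_null (F : forall i, {linear P i -> P' i}) :
  (forall x, pres_aug P' (F 0%N x) = 0) -> chain_map F -> forall i,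
  exists h : {linear P i -> P' i.+1},
    (forall y, pres_d P' i (h (pres_d P i y)) = F i (pres_d P i y)) /\
    match i return {linear P i -> P' i.+1} -> Prop with
    | 0%N => fun h => forall x, F 0%N x = pres_d P' 0%N (h x)
    | j.+1 => fun h => exists h' : {linear P j -> P' j.+1},
        forall x, F j.+1 x = pres_d P' j.+1 (h x) + h' (pres_d P j x)
    end h.
Proof.
move=> F0 hF; elim=> [|i [h [hh _]]].
  have [|h hh] := projective_lift (g := pres_d P' 0%N) (f := F 0%N) (@pres_proj _ _ P 0%N).
    by move=> x; apply/pres_exact0.
  by exists h; split=> // y; rewrite hh.
pose f := (F i.+1 \- (h \o pres_d P i))%FUN.
have [|h1 hh1] := projective_lift (g := pres_d P' i.+1) (f := f) (@pres_proj _ _ P i.+1).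
  by move=> x; apply: (iffLR (pres_exact _)); rewrite /f /= linearB /= -hF hh subrr.
exists h1; split; last by exists h => x; rewrite hh1 /f /= subrK.
move=> y; rewrite hh1 /f /= (_ : pres_d P i _ = 0) ?linear0 ?addr0 //.
by apply/pres_exact; exists y.
Qed.

Variable X : lmodType A.

Lemma chain_null_coboundary (F : forall i, {linear P i -> P' i}) i
    (f : {linear P' i -> X}) :
  (forall x, pres_aug P' (F 0%N x) = 0) -> chain_map F ->
  cocycle f -> coboundary (fun x => f (F i x)).
Proof.
move=> F0 hF hf; have [h [_]] := chain_null F0 hF i.
case: i f hf h => [|i] f hf h.
  by move=> hh x; rewrite hh hf.
move=> [h' hh]; exists (f \o h')%FUN => x /=.
by rewrite hh linearD /= hf add0r.
Qed.

Lemma coboundary_chain (F : forall i, {linear P i -> P' i}) i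
    (f : P' i -> X) :
  chain_map F -> coboundary f -> coboundary (fun x => f (F i x)).
Proof.
case: i f => [|i] f hF /=; first by move=> h x; rewrite h.
by move=> [g hg]; exists (g \o F i)%FUN => x; rewrite hg /= hF.
Qed.

Lemma eq_coboundary i (f g : P i -> X) : f =1 g -> coboundary f -> coboundary g.
Proof. by move=> /funext ->. Qed.

Lemma coboundaryB i (f g : P i -> X) :
  coboundary f -> coboundary g -> coboundary (fun x => f x - g x).
Proof.
case: i f g => [|i] f g /=; first by move=> h h' x; rewrite h h' subr0.
move=> [u hu] [v hv]; exists (u \- v)%FUN => x /=; by rewrite hu hv.
Qed.

End Resolutions.

(** [Ext_eq0] ranges over all resolutions; one suffices. With comparison maps [F] and [G], the
    composite [G F] lifts the identity, so [f] and [f G F] differ by a coboundary, and [f G] is a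
    cocycle on [T]. *)
Lemma Ext_eq0_resolution (M X : lmodType A) (T : proj_resolution M) i :
  (forall f : {linear T i -> X}, cocycle f -> coboundary f) -> Ext_eq0 M X i.
Proof.
move=> hT P f hf.
have [F [aF hF]] := chain_lift P T idfun.
have [G [aG hG]] := chain_lift T P idfun.
have c1 : coboundary (fun x => f (G i (F i x))).
  apply: (coboundary_chain (f := (f \o G i)%FUN) hF); apply: hT => y /=.
  by rewrite hG hf.
pose H i := ((G i \o F i) \- idfun)%FUN : {linear P i -> P i}.
have H0 x : pres_aug P (H 0%N x) = 0.
  by rewrite /H /= linearB /= aG aF subrr.
have cH : chain_map H.
  by move=> j x; rewrite /H /= hF hG linearB.
have c2 := chain_null_coboundary H0 cH hf.
apply: eq_coboundary (coboundaryB c1 c2) => x.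
by rewrite /H /= linearB /= opprB addrC subrK.
Qed.

End Homological.

(** * Extension of scalars *)

Section Restriction.
Variables A B : nzRingType.

(** An alias indexed by [phi], so that the [A]-module structure does not collide with the [B]-module
    structure of [X]. *)
Definition restriction (phi : {rmorphism A -> B}) (X : lmodType B) : Type := X.

Variables (phi : {rmorphism A -> B}) (X : lmodType B).
Local Notation rX := (restriction phi X).

HB.instance Definition _ := GRing.Zmodule.copy rX X.

Definition restr_scale (a : A) (x : rX) : rX := phi a *: (x : X).

Fact restr_scaleA a b x : restr_scale a (restr_scale b x) = restr_scale (a * b) x.
Proof. by rewrite /restr_scale scalerA rmorphM. Qed.
Fact restr_scale1 : left_id 1 restr_scale.
Proof. by move=> x; rewrite /restr_scale rmorph1 scale1r. Qed.
Fact restr_scaleDr : right_distributive restr_scale +%R.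
Proof. by move=> a x y; rewrite /restr_scale scalerDr. Qed.
Fact restr_scaleDl x : {morph restr_scale^~ x : a b / a + b}.
Proof. by move=> a b; rewrite /restr_scale rmorphD scalerDl. Qed.

HB.instance Definition _ := GRing.Zmodule_isLmodule.Build A rX
  restr_scaleA restr_scale1 restr_scaleDr restr_scaleDl.

Lemma restr_scaleE (a : A) (x : rX) : a *: x = phi a *: (x : X).
Proof. by []. Qed.

End Restriction.

Section Tensor.
Variables (A B : nzRingType) (phi : {rmorphism A -> B}).

Section Elements.
Variable U : lmodType A.
Local Notation "b '(x)' u" := (tens phi b u) (at level 35).
Local Notation BU := (extend_scalars phi U).

Lemma tensZ c b (u : U) : c *: (b (x) u) = (c * b) (x) u.
Proof. exact: tens_scaleE. Qed.

Lemma tensDr b (u u' : U) : b (x) (u + u') = b (x) u + b (x) u'.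
Proof. by rewrite /tens tens_piD; apply/tensW/tens_Dr. Qed.

Lemma tens_balanced b a (u : U) : (b * phi a) (x) u = b (x) (a *: u).
Proof. exact/tensW/tens_bal. Qed.

Lemma tensDl b b' (u : U) : (b + b') (x) u = b (x) u + b' (x) u.
Proof. by rewrite /tens tens_piD; apply/tensW/tens_Dl. Qed.

Lemma tens0l (u : U) : 0 (x) u = 0.
Proof. exact/tensW/tens_0l. Qed.

Lemma tens0r b : b (x) (0 : U) = 0.
Proof. by rewrite -(scale0r (0 : U)) -tens_balanced rmorph0 mulr0 tens0l. Qed.

Lemma tens_suml I (r : seq I) (F : I -> B) (u : U) :
  (\sum_(i <- r) F i) (x) u = \sum_(i <- r) F i (x) u.
Proof. exact: (big_morph (fun b => b (x) u) (fun b b' => tensDl b b' u) (tens0l u)). Qed.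

Lemma tens_ind (P : BU -> Prop) : P 0 -> (forall x y, P x -> P y -> P (x + y)) ->
  (forall b u, P (b (x) u)) -> forall x, P x.
Proof.
move=> P0 PD Pt; apply: tens_quotW; elim=> [|[b u] s IH]; first exact: P0.
by rewrite -cat1s -tens_piD; apply: PD => //; apply: Pt.
Qed.

Variables (X : zmodType) (f : B -> U -> X).
Hypothesis fDl : forall b b' u, f (b + b') u = f b u + f b' u.
Hypothesis fDr : forall b u u', f b (u + u') = f b u + f b u'.
Hypothesis fbal : forall b a u, f (b * phi a) u = f b (a *: u).

(** The target is only an additive group: this serves both the Frobenius map and the coordinate maps
    of the dual basis, the latter not being [B]-linear. *)
Definition tens_lift (x : BU) : X := \sum_(p <- repr x) f p.1 p.2.

Lemma tens_lift_pi s : tens_lift (\pi_BU s)%qT = \sum_(p <- s) f p.1 p.2.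
Proof.
have f0 u : f 0 u = 0.
  by apply: (addrI (f 0 u)); rewrite -fDl !addr0.
have H : forall s s', tens_eq phi s s' ->
    \sum_(p <- s) f p.1 p.2 = \sum_(p <- s') f p.1 p.2.
  move=> s1 s2; elim=> {s1 s2} //.
  - by move=> s1 s2 s3 _ -> _ ->.
  - by move=> s1 s2 s1' s2' _ h1 _ h2; rewrite !big_cat /= h1 h2.
  - by move=> s1 s2; rewrite !big_cat /= addrC.
  - by move=> u; rewrite big_seq1 big_nil f0.
  - by move=> b b' u; rewrite !big_cons !big_nil !addr0 /= fDl.
  - by move=> b u u'; rewrite !big_cons !big_nil !addr0 /= fDr.
  - by move=> b a u; rewrite !big_seq1 /= fbal.
by rewrite /tens_lift; apply/H/tens_repr.
Qed.

Lemma tens_liftE b u : tens_lift (b (x) u) = f b u.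
Proof. by rewrite tens_lift_pi big_seq1. Qed.

Lemma tens_liftD : {morph tens_lift : x y / x + y}.
Proof.
move=> x y; elim/tens_quotW: x => x; elim/tens_quotW: y => y.
by rewrite tens_piD !tens_lift_pi big_cat.
Qed.

Lemma tens_lift0 : tens_lift 0 = 0.
Proof. by apply: (addrI (tens_lift 0)); rewrite -tens_liftD !addr0. Qed.

End Elements.

Section Frobenius.
Variables (U : lmodType A) (X : lmodType B) (f : {linear U -> restriction phi X}).

Definition ind_fun (b : B) (u : U) : X := b *: (f u : X).

Definition ind_lift : extend_scalars phi U -> X := tens_lift ind_fun.

Fact ind_funDl b b' u : ind_fun (b + b') u = ind_fun b u + ind_fun b' u.
Proof. exact: scalerDl. Qed.
Fact ind_funDr b u u' : ind_fun b (u + u') = ind_fun b u + ind_fun b u'.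
Proof. by rewrite /ind_fun linearD [LHS]scalerDr. Qed.
Fact ind_fun_bal b a u : ind_fun (b * phi a) u = ind_fun b (a *: u).
Proof. by rewrite /ind_fun linearZ_LR restr_scaleE scalerA. Qed.

Lemma ind_liftE b u : ind_lift (tens phi b u) = b *: (f u : X).
Proof. exact: tens_liftE ind_funDl ind_funDr ind_fun_bal _ _. Qed.

Fact ind_lift_linear : linear ind_lift.
Proof.
move=> c x y; rewrite /ind_lift (tens_liftD ind_funDl ind_funDr ind_fun_bal).
congr (_ + _); rewrite -!/(ind_lift _); elim/tens_ind: x => [||b u].
- by rewrite scaler0 /ind_lift (tens_lift0 ind_funDl ind_funDr ind_fun_bal) scaler0.
- move=> x x' h h'; rewrite scalerDr /ind_lift.
  rewrite !(tens_liftD ind_funDl ind_funDr ind_fun_bal) scalerDr.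
  by rewrite -!/(ind_lift _) h h'.
- by rewrite tensZ !ind_liftE scalerA.
Qed.

HB.instance Definition _ :=
  GRing.isLinear.Build B (extend_scalars phi U) X *:%R ind_lift ind_lift_linear.

End Frobenius.

Section Unit.
Variable U : lmodType A.

Definition ind_unit (u : U) : restriction phi (extend_scalars phi U) := tens phi 1 u.

Fact ind_unit_linear : linear ind_unit.
Proof.
move=> a u u'; rewrite /ind_unit tensDr -tens_balanced mul1r restr_scaleE.
by rewrite tensZ mulr1.
Qed.

HB.instance Definition _ := GRing.isLinear.Build A U
  (restriction phi (extend_scalars phi U)) *:%R ind_unit ind_unit_linear.

End Unit.

Definition ind_map (U U' : lmodType A) (f : {linear U -> U'}) :
    {linear extend_scalars phi U -> extend_scalars phi U'} :=
  ind_lift (@ind_unit U' \o f)%FUN.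

Lemma ind_mapE (U U' : lmodType A) (f : {linear U -> U'}) b u :
  ind_map f (tens phi b u) = tens phi b (f u).
Proof. by rewrite /ind_map /= ind_liftE /= /ind_unit tensZ mulr1. Qed.

Lemma ind_ext (U : lmodType A) (X : lmodType B)
    (f g : {linear extend_scalars phi U -> X}) :
  (forall u, f (tens phi 1 u) = g (tens phi 1 u)) -> f =1 g.
Proof.
move=> h; apply: tens_ind => [|x y hx hy|b u]; rewrite ?linear0 ?linearD ?hx ?hy //.
by rewrite -[b]mulr1 -tensZ !linearZ_LR h.
Qed.

(** Induction is left adjoint to restriction, and restriction keeps surjections; the packed maps are
    [g] and [f] read as [A]-linear maps. *)
Lemma ind_projective (U : lmodType A) : projective U -> projective (extend_scalars phi U).
Proof.
move=> hU M N g f hg.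
pose gr : restriction phi M -> restriction phi N := g.
have gr_lin : linear gr by move=> a x y; rewrite /gr linearP.
pose grL := HB.pack_for {linear restriction phi M -> restriction phi N} gr
  (GRing.isLinear.Build A (restriction phi M) (restriction phi N) *:%R gr gr_lin).
pose fr : restriction phi (extend_scalars phi U) -> restriction phi N := f.
have fr_lin : linear fr by move=> a x y; rewrite /fr linearP.
pose frL := HB.pack_for {linear restriction phi (extend_scalars phi U) -> restriction phi N} fr
  (GRing.isLinear.Build A _ (restriction phi N) *:%R fr fr_lin).
have [h hh] := hU _ _ grL (frL \o @ind_unit U)%FUN hg.
exists (ind_lift h); apply: (ind_ext (f := (g \o ind_lift h)%FUN)) => u /=.
by rewrite ind_liftE scale1r; apply: hh.
Qed.

(** The dual basis lemma: [B] is projective as a right [A]-module. *)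
Definition right_dual_basis (I : finType) (e : I -> B) (c : I -> B -> A) : Prop :=
  [/\ forall i b b', c i (b + b') = c i b + c i b',
      forall i b a, c i (b * phi a) = c i b * a
    & forall b, b = \sum_i e i * phi (c i b)].

Section Flat.
Variables (I : finType) (e : I -> B) (c : I -> B -> A).
Hypothesis ec : right_dual_basis e c.

Let coord (U : lmodType A) i : extend_scalars phi U -> U :=
  tens_lift (fun b u => c i b *: u).

Let coordE (U : lmodType A) i b u : coord i (tens phi b u) = c i b *: u :> U.
Proof.
case: ec => cD cM _; apply: tens_liftE => *; rewrite ?cD ?cM ?scalerDl //.
- by rewrite scalerDr.
- by rewrite scalerA.
Qed.

Let coordD (U : lmodType A) i : {morph @coord U i : x y / x + y}.
Proof.
case: ec => cD cM _; apply: tens_liftD => *; rewrite ?cD ?cM ?scalerDl //.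
- by rewrite scalerDr.
- by rewrite scalerA.
Qed.

Let coord0 (U : lmodType A) i : @coord U i 0 = 0.
Proof. by apply: (addrI (coord i 0)); rewrite -coordD !addr0. Qed.

Let coord_sum (U : lmodType A) (x : extend_scalars phi U) :
  x = \sum_i tens phi (e i) (coord i x).
Proof.
elim/tens_ind: x => [|x y hx hy|b u].
- by rewrite big1 // => i _; rewrite coord0 tens0r.
- by rewrite {1}hx {1}hy -big_split /=; apply: eq_bigr => i _; rewrite coordD tensDr.
- case: ec => _ _ eb; rewrite {1}[b]eb tens_suml; apply: eq_bigr => i _.
  by rewrite coordE tens_balanced.
Qed.

Let coord_map (U U' : lmodType A) (f : {linear U -> U'}) i x :
  coord i (ind_map f x) = f (coord i x).
Proof.
elim/tens_ind: x => [|x y hx hy|b u]; first by rewrite linear0 !coord0 linear0.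
  by rewrite linearD !coordD linearD hx hy.
by rewrite ind_mapE !coordE linearZ_LR.
Qed.

(** An induced element is the sum of the [e i (x) coord i y], and the coordinates commute with
    induced maps, so preimages can be taken coordinate by coordinate. *)
Lemma ind_exact (U U' U'' : lmodType A) (f : {linear U -> U'}) (g : {linear U' -> U''}) :
  (forall y, g y = 0 <-> exists x, f x = y) ->
  forall y, ind_map g y = 0 <-> exists x, ind_map f x = y.
Proof.
move=> fg y; split=> [gy|[x <-]].
  have h i : exists x, f x = coord i y by apply/fg; rewrite -coord_map gy coord0.
  exists (\sum_i tens phi (e i) (sval (cid (h i)))).
  rewrite [RHS]coord_sum linear_sum; apply: eq_bigr => i _; rewrite ind_mapE.
  by case: cid => x /= ->.
elim/tens_ind: x => [|x x' hx hx'|b u]; first by rewrite !linear0.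
  by rewrite !linearD hx hx' addr0.
by rewrite !ind_mapE (_ : g (f u) = 0) ?tens0r //; apply/fg; exists u.
Qed.

Lemma ind_surj (U U' : lmodType A) (f : {linear U -> U'}) :
  surjective_map f -> surjective_map (ind_map f).
Proof.
move=> hf; apply: tens_ind => [|y y' [x <-] [x' <-]|b u].
- by exists 0; rewrite linear0.
- by exists (x + x'); rewrite linearD.
- by have [x <-] := hf u; exists (tens phi b x); rewrite ind_mapE.
Qed.

Definition ind_resolution (U : lmodType A) (Q : proj_resolution U) :
  proj_resolution (extend_scalars phi U) :=
  @ProjResolution B (extend_scalars phi U) (fun i => extend_scalars phi (Q i))
    (fun i => ind_map (pres_d Q i)) (ind_map (pres_aug Q))
    (fun i => ind_projective (@pres_proj _ _ Q i)) (ind_surj (@pres_aug_surj _ _ Q))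
    (ind_exact (@pres_exact0 _ _ Q)) (fun i => ind_exact (@pres_exact _ _ Q i)).

End Flat.

End Tensor.

Section CentralMul.
Variable A : nzRingType.

(** The centrality proof is what makes the map linear. *)
Definition central_mul (a : A) (ha : forall b, GRing.comm a b) (U : lmodType A)
  (u : U) : U := a *: u.

Variables (a : A) (ha : forall b, GRing.comm a b) (U : lmodType A).

Fact central_mul_linear : linear (@central_mul a ha U).
Proof. by move=> b u v; rewrite /central_mul scalerDr !scalerA ha. Qed.

HB.instance Definition _ :=
  GRing.isLinear.Build A U U *:%R (@central_mul a ha U) central_mul_linear.

End CentralMul.

(** * Vanishing of Ext through central elements of the smaller algebra *)

Section ExtVanishing.
Variables (K : fieldType) (A : algType K) (B : nzRingType) (phi : {rmorphism A -> B}).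
Variables (I : finType) (e : I -> B) (c : I -> B -> A).
Hypothesis ec : right_dual_basis phi e c.
Variables (U : lmodType A) (X : lmodType B) (Q : proj_resolution U).

Local Notation T := (ind_resolution ec Q).
Local Notation central a := (forall b : A, GRing.comm a b).

(** [a] is central in [A] only, so it acts through the factor [Q i]; multiplication by [phi a] need
    not be [B]-linear. *)
Let act a (ha : central a) i : {linear T i -> T i} := ind_map phi (@central_mul A a ha (Q i)).

Let actE a (ha : central a) i b q :
  act ha i (tens phi b q) = tens phi b (a *: q).
Proof. exact: ind_mapE. Qed.

Let act_chain a (ha : central a) : chain_map (act ha).
Proof.
move=> i x; elim/tens_ind: x => [|x y hx hy|b q]; first by rewrite !linear0.
  by rewrite !linearD hx hy.
by rewrite actE /= !ind_mapE linearZ_LR.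
Qed.

Let act_cocycle a (ha : central a) i (f : {linear T i -> X}) :
  cocycle f -> cocycle (f \o act ha i)%FUN.
Proof. by move=> hf y /=; rewrite act_chain hf. Qed.

Let act_null a (ha : central a) i (f : {linear T i -> X}) :
  (forall u : U, a *: u = 0) -> cocycle f -> coboundary (fun x => f (act ha i x)).
Proof.
move=> aU; apply: chain_null_coboundary; last exact: act_chain.
move=> x; elim/tens_ind: x => [|x y hx hy|b q]; first by rewrite !linear0.
  by rewrite !linearD hx hy addr0.
by rewrite actE /= ind_mapE linearZ_LR aU tens0r.
Qed.

Let prod_shift (L : seq (A * K)) : A := \prod_(p <- L) (p.1 + p.2%:A).

Let centralA (k : K) : central (k%:A : A).
Proof. by move=> b; rewrite /GRing.comm -scalerAl -scalerAr mul1r mulr1. Qed.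

Let centralD a b : central a -> central b -> central (a + b).
Proof. by move=> ha hb x; rewrite /GRing.comm mulrDl mulrDr ha hb. Qed.

Let centralM a b : central a -> central b -> central (a * b).
Proof. by move=> ha hb x; rewrite /GRing.comm -mulrA hb mulrA ha mulrA. Qed.

Let prod_shift_central L : (forall p, p \in L -> central p.1) -> central (prod_shift L).
Proof.
elim: L => [|p L IH] h; rewrite /prod_shift ?big_nil ?big_cons.
  by move=> b; apply: commr_sym; apply: commr1.
apply: centralM; first by apply: centralD; [apply: h; rewrite mem_head | apply: centralA].
by apply: IH => q qL; apply: h; rewrite inE qL orbT.
Qed.

(** The central elements [a] for which [f \o (id (x) a)] is a coboundary form an
    ideal; it contains all [p.1], and [prod_shift L] is congruent to the
    product of the [p.2] modulo the [p.1]. *)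
Let coboundary_prod_shift (L : seq (A * K)) (hL : forall p, p \in L -> central p.1) :
  (forall p, p \in L -> p.2 != 0 /\ forall u : U, p.1 *: u = 0) ->
  forall i (f : {linear T i -> X}), cocycle f ->
  coboundary (fun x => f (act (prod_shift_central hL) i x)) -> coboundary f.
Proof.
elim: L hL => [|p L IH] hL h i f hf hc.
  apply: eq_coboundary hc => x; congr (f _).
  elim/tens_ind: x => [|x y hx hy|b q]; rewrite ?linear0 ?linearD ?hx ?hy //.
  by rewrite actE /prod_shift big_nil scale1r.
have hL' q : q \in L -> central q.1 by move=> qL; apply: (hL q); rewrite inE qL orbT.
have [p0 pU] := h p (mem_head _ _).
have h' q : q \in L -> q.2 != 0 /\ forall u : U, q.1 *: u = 0.
  by move=> qL; apply: h; rewrite inE qL orbT.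
apply: (IH hL' h' i f hf).
have hp := hL p (mem_head _ _).
pose g : {linear T i -> X} := (f \o act (prod_shift_central hL') i)%FUN.
have cg : cocycle g by apply: act_cocycle.
(* Removing [p.1] times [prod_shift L], a coboundary since [p.1] kills [U], leaves [p.2] times
   [prod_shift L]; composing with [p.2^-1] then removes the scalar. *)
have c1 : coboundary (fun x => f (act (prod_shift_central hL) i x) - g (act hp i x)).
  exact: coboundaryB hc (act_null hp pU cg).
have := coboundary_chain (act_chain (centralA p.2^-1)) c1.
apply: eq_coboundary => x.
elim/tens_ind: x => [|x y hx hy|b q].
- by rewrite !linear0 addr0.
- by rewrite !linearD -hx -hy /= addrACA.
rewrite /g /= !actE -linearB /=; congr (f _).
rewrite -[X in _ = X]addr0 -(subrr (tens phi b (prod_shift L *: (p.1 *: (p.2^-1%:A *: q))))) addrA.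
congr (_ - _); rewrite -tensDr; congr tens.
rewrite [prod_shift (p :: L)]big_cons -/(prod_shift L).
have hl := prod_shift_central hL'.
have -> : (p.1 + p.2%:A) * prod_shift L = prod_shift L * (p.1 + p.2%:A).
  exact/commr_sym/hl.
rewrite -scalerA scalerDl scalerDr addrC; congr (_ + _); congr (_ *: _).
by rewrite scalerA -scalerAl mul1r scalerA divff // !scale1r.
Qed.

(** On cochains the product may be moved across the tensor sign and out of [f], where it acts on [X]
    by zero. So every cocycle composed with it is the zero cochain. *)
Lemma Ext_vanishing (L : seq (A * K)) :
  (forall p, p \in L -> [/\ forall b : A, GRing.comm p.1 b, p.2 != 0
     & forall u : U, p.1 *: u = 0]) ->
  (forall x : X, phi (\prod_(p <- L) (p.1 + p.2%:A)) *: x = 0) ->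
  forall i, Ext_eq0 (extend_scalars phi U) X i.
Proof.
move=> hL hX i; apply: (Ext_eq0_resolution (T := T)) => f hf.
have hc p : p \in L -> central p.1 by case/hL.
apply: (coboundary_prod_shift (hL := hc)) => //; first by move=> p /hL [].
suff -> : (fun x => f (act (prod_shift_central hc) i x)) = (fun=> 0).
  by case: i f hf => [|i] f hf //=; exists (\0)%FUN => x.
apply: funext => x.
elim/tens_ind: x => [|x y hx hy|b q]; rewrite ?linear0 ?linearD ?hx ?hy ?addr0 //.
rewrite actE -tens_balanced -[_ * _]mulr1 -tensZ linearZ_LR -scalerA hX scaler0.
by [].
Qed.

End ExtVanishing.

(** * Commuting operators on a finite-dimensional module *)

Section FiniteDimensional.
Variables (K : closedFieldType) (A : algType K) (U : lmodType A).

Lemma scalar_comm (k : K) (a : A) : k%:A * a = a * k%:A.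
Proof. by rewrite -scalerAl -scalerAr mul1r mulr1. Qed.

(** [finite_dim] gives a spanning family, not a basis; any matrix expressing [z] on it still
    satisfies Cayley-Hamilton, and its characteristic polynomial splits. The empty family is
    separate because [horner_mx] needs matrices of positive size. *)
Lemma finite_dim_split_annihilator (z : A) : finite_dim U ->
  exists L : seq K, forall u : U, (\prod_(l <- L) (z - l%:A)) *: u = 0.
Proof.
case=> [[|m]] [b hb].
  by exists [::] => u; have [k ->] := hb u; rewrite big_ord0 scaler0.
have [X hX] : exists X : 'M[K]_m.+1, forall i, z *: b i = \sum_l (X i l)%:A *: b l.
  have [X hX] := choice (fun i => hb (z *: b i)).
  by exists (\matrix_(i, l) X i l) => i; rewrite hX; apply: eq_bigr => l _; rewrite mxE.
have hp p i : horner_alg z p *: b i = \sum_l (horner_mx X p i l)%:A *: b l.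
  elim/poly_ind: p i => [|p k IH] i.
    by rewrite !rmorph0 scale0r big1 // => l _; rewrite mxE !scale0r.
  rewrite !rmorphD !rmorphM /= horner_algX horner_algC horner_mx_X horner_mx_C.
  rewrite scalerDl -scalerA hX scaler_sumr.
  rewrite (eq_bigr (fun l => \sum_q (X i l)%:A *: ((horner_mx X p l q)%:A *: b q))); last first.
    by move=> l _; rewrite scalerA -scalar_comm -scalerA IH scaler_sumr.
  rewrite exchange_big /=.
  have -> : horner_mx X p * X = X *m horner_mx X p by exact: comm_horner_mx.
  transitivity (\sum_l ((X *m horner_mx X p) i l)%:A *: b l + \sum_l (k%:M i l)%:A *: b l).
    congr (_ + _); last first.
      rewrite (bigD1 i) //= big1 ?addr0 ?mxE ?eqxx ?mulr1n // => l li.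
      by rewrite mxE eq_sym (negPf li) mulr0n !scale0r.
    apply: eq_bigr => l _; rewrite mxE !scaler_suml; apply: eq_bigr => q _.
    by rewrite scalerA -scalerAl mul1r scalerA.
  by rewrite -big_split /=; apply: eq_bigr => l _; rewrite [in RHS]mxE !scalerDl.
have [L hL] := closed_field_poly_normal (char_poly X).
rewrite (monicP (char_poly_monic X)) scale1r in hL.
exists L => u; have [k ->] := hb u; rewrite scaler_sumr big1 // => i _.
rewrite scalerA -scalar_comm -scalerA (_ : _ *: b i = 0) ?scaler0 //.
have := hp (char_poly X) i; rewrite Cayley_Hamilton [RHS]big1 => [<-|l _]; last first.
  by rewrite mxE !scale0r.
congr (_ *: _); rewrite hL rmorph_prod; apply: eq_bigr => l _.
by rewrite rmorphB /= horner_algX horner_algC.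
Qed.

Variables (n : nat) (x : {linear 'cV[K]_n -> A}).
Hypothesis xC : forall v v', x v * x v' = x v' * x v.

Definition shift (g : 'rV[K]_n) v : A := x v - (pairing g v)%:A.

Lemma shiftC g v g' v' : shift g v * shift g' v' = shift g' v' * shift g v.
Proof.
apply: commrB; last exact/commr_sym/scalar_comm.
by apply: commr_sym; apply: commrB; [apply: xC | apply/commr_sym/scalar_comm].
Qed.

(** Every product of operators [x v - g v], with one arbitrary [v] for each [g]
    in [D], kills [u]. *)
Fixpoint killed (D : seq 'rV[K]_n) (u : U) : Prop :=
  if D is g :: D' then forall v, killed D' (shift g v *: u) else u = 0.

Lemma killed0 D : killed D 0.
Proof. by elim: D => //= g D IH v; rewrite scaler0. Qed.

Lemma killedD D u u' : killed D u -> killed D u' -> killed D (u + u').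
Proof.
elim: D u u' => [|g D IH] u u' /=; first by move=> -> ->; rewrite addr0.
by move=> h h' v; rewrite scalerDr; apply: IH.
Qed.

Lemma killed_sum D I (r : seq I) (P : pred I) (F : I -> U) :
  (forall i, P i -> killed D (F i)) -> killed D (\sum_(i <- r | P i) F i).
Proof. by move=> h; elim/big_ind: _ => //; [apply: killed0 | apply: killedD]. Qed.

Lemma killedZ D a u : (forall g v, a * shift g v = shift g v * a) ->
  killed D u -> killed D (a *: u).
Proof.
move=> ha; elim: D u => [|g D IH] u /=; first by move=> ->; rewrite scaler0.
by move=> h v; rewrite scalerA -ha -scalerA; apply: IH.
Qed.

Lemma killed_shift D g v u : killed D u -> killed D (shift g v *: u).
Proof. by apply: killedZ => g' v'; apply: shiftC. Qed.

Lemma killed_scalar D (k : K) u : killed D u -> killed D (k%:A *: u).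
Proof. by apply: killedZ => g' v'; apply: scalar_comm. Qed.

Lemma killed_mid D1 D2 g u : killed (D1 ++ g :: D2) u <-> killed (g :: D1 ++ D2) u.
Proof.
elim: D1 u => [|h D1 IH] u //=; split=> H v.
  by move=> v'; have /IH := H v' => /(_ v); rewrite !scalerA shiftC.
by apply/IH => v'; have := H v' v; rewrite !scalerA shiftC.
Qed.

Lemma killed_perm D D' u : perm_eq D D' -> killed D u -> killed D' u.
Proof.
elim: D D' u => [|g D IH] D' u; first by rewrite perm_sym => /perm_nilP ->.
move=> hp; have gD' : g \in D' by rewrite -(perm_mem hp) mem_head.
case/splitPr: gD' hp => D1 D2 hp h.
apply/killed_mid => v; apply: IH; last exact: h.
by move: hp; rewrite perm_sym perm_catC /= perm_cons perm_sym => /perm_trans; apply; rewrite perm_catC.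
Qed.

Lemma killed_catr D D' u : killed D' u -> killed (D ++ D') u.
Proof. by elim: D u => //= g D IH u h v; apply/IH/killed_shift. Qed.

Lemma killed_catl D D' u : killed D u -> killed (D ++ D') u.
Proof. by move=> h; apply: killed_perm (killed_catr D' h); rewrite perm_catC. Qed.

Lemma killed_flatten (I : eqType) (r : seq I) (F : I -> seq 'rV[K]_n) i u :
  i \in r -> killed (F i) u -> killed (flatten [seq F i | i <- r]) u.
Proof.
elim: r => [|j r IH] //=; rewrite inE => /orP [/eqP <-|ir] h; first exact: killed_catl.
by apply: killed_catr; apply: IH.
Qed.

Lemma killed_prod D u (v : 'rV[K]_n -> 'cV[K]_n) : killed D u ->
  (\prod_(g <- D) shift g (v g)) *: u = 0.
Proof.
elim: D u => [|g D IH] u /=; first by move=> ->; rewrite scaler0.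
move=> h; rewrite big_cons (_ : _ * _ = (\prod_(g <- D) shift g (v g)) * shift g (v g)).
  by rewrite -scalerA IH.
apply: commr_prod => g' _; exact: shiftC.
Qed.

Definition joint_eigenvalue g := exists2 u : U, u != 0 & forall v, shift g v *: u = 0.

Lemma killed_filter D u :
  killed D u -> killed [seq g <- D | `[< joint_eigenvalue g >]] u.
Proof.
elim: D u => [|g D IH] u //=; case: asboolP => [gw h v|gw h]; first exact/IH/h.
apply: IH; have {}h : killed (rcons D g) u.
  by apply: (@killed_perm (g :: D)) => //; rewrite perm_sym perm_rcons.
elim: D u h => [|g' D IH] u /= h; last by move=> v; apply: IH.
by apply: contrapT => u0; apply: gw; exists u => //; apply/eqP.
Qed.

Lemma shift_sum g v : shift g v = \sum_j (v j 0)%:A * shift g (delta_mx j 0).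
Proof.
have ev : v = \sum_j v j 0 *: delta_mx j 0.
  by rewrite {1}(matrix_sum_delta v); apply: eq_bigr => j _; rewrite big_ord1.
have ex : x v = \sum_j v j 0 *: x (delta_mx j 0).
  by rewrite {1}ev linear_sum; apply: eq_bigr => j _; rewrite linearZ.
have eg : pairing g v = \sum_j v j 0 * pairing g (delta_mx j 0).
  by rewrite {1}ev pairing_sumr; apply: eq_bigr => j _; rewrite pairingZr.
rewrite /shift ex eg scaler_suml -sumrB.
by apply: eq_bigr => j _; rewrite mulrBr -!scalerAl !mul1r scalerA.
Qed.

(** Induction on the total number of factors. Let [g] be the tuple of heads: [shift g v] is a
    combination of the [shift g (delta_mx i 0)], and the [i]-th of these strips one factor from
    [L i]. The lists obtained for the various [i] are concatenated. If some [L j] is empty, then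
    [u = 0]. *)
Lemma killed_exists (L : 'I_n -> seq K) : exists D, forall u,
  (forall j, (\prod_(l <- L j) (x (delta_mx j 0) - l%:A)) *: u = 0) -> killed D u.
Proof.
have [m] := ubnP (\sum_j size (L j)); elim: m L => // m IH L hm.
have [[j Lj]|L0] := pselect (exists j, L j = [::]).
  by exists [::] => u /(_ j); rewrite Lj big_nil scale1r.
have Lc j : L j = head 0 (L j) :: behead (L j).
  by case e : (L j) => //; case: L0; exists j.
pose L' i j := if j == i then behead (L j) else L j.
have hL' i : (\sum_j size (L' i j) < m)%N.
  have e : (\sum_j size (L' i j)).+1 = (\sum_j size (L j))%N.
    rewrite (bigD1 i) //= [RHS](bigD1 i) //= {1}/L' eqxx [in RHS]Lc /= addSn.
    by congr (_ + _).+1; apply: eq_bigr => j /negPf ji; rewrite /L' ji.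
  by rewrite -ltnS e.
have [D hD] := choice (fun i => IH _ (hL' i)).
pose g : 'rV[K]_n := \row_j head 0 (L j).
exists (g :: flatten [seq D i | i <- enum 'I_n]) => u hu v.
rewrite shift_sum scaler_suml; apply: killed_sum => i _.
rewrite -scalerA; apply: killed_scalar.
apply: (killed_flatten (i := i)); first by rewrite mem_enum.
have eg : shift g (delta_mx i 0) = x (delta_mx i 0) - (head 0 (L i))%:A.
  rewrite /shift /pairing; congr (_ - _%:A); rewrite mxE (bigD1 i) //= big1 => [|j ji].
    by rewrite !mxE !eqxx mulr1 addr0.
  by rewrite !mxE (negPf ji) mulr0.
apply: hD => j; rewrite /L'; case: eqP => [->|_]; last first.
  rewrite scalerA (_ : _ * _ = shift g (delta_mx i 0) *
    \prod_(l <- L j) (x (delta_mx j 0) - l%:A)); first by rewrite -scalerA hu scaler0.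
  apply/esym; apply: commr_prod => l _; rewrite eg.
  apply: commrB; last by apply: commr_sym; apply: scalar_comm.
  apply: commr_sym; apply: commrB; last by apply: commr_sym; apply: scalar_comm.
  exact: xC.
rewrite eg scalerA (_ : _ * _ = \prod_(l <- L i) (x (delta_mx i 0) - l%:A)) //.
rewrite [in RHS]Lc big_cons; apply/esym; apply: commr_prod => l _.
apply: commrB; last by apply: commr_sym; apply: scalar_comm.
by apply: commr_sym; apply: commrB => //; apply: commr_sym; apply: scalar_comm.
Qed.

Lemma finite_dim_killed : finite_dim U ->
  exists2 D, forall g, g \in D -> joint_eigenvalue g & forall u, killed D u.
Proof.
move=> fdU.
have [L hL] := choice (fun j => finite_dim_split_annihilator (x (delta_mx j 0)) fdU).
have [D hD] := killed_exists L.
exists [seq g <- D | `[< joint_eigenvalue g >]].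
  by move=> g; rewrite mem_filter => /andP [/asboolP].
by move=> u; apply/killed_filter/hD.
Qed.

End FiniteDimensional.

(** * The PBW theorem *)

Section SubalgebraTheory.
Variables (K : comNzRingType) (A : algType K) (G : A -> Prop).

Lemma in_subalg_ind (P : A -> Prop) : P 1 ->
  (forall a u v, P u -> P v -> P (a *: u + v)) ->
  (forall u v, P u -> P v -> P (u * v)) -> (forall g, G g -> P g) ->
  forall h, h \in in_subalg G -> P h.
Proof.
move=> P1 PZ PM PG h /asboolP hS; apply/asboolP.
apply: (hS (fun h => `[< P h >])); last by move=> g /PG /asboolP.
split; first exact/asboolP.
  by move=> a u v /asboolP hu /asboolP hv; apply/asboolP/PZ.
by move=> u v /asboolP hu /asboolP hv; apply/asboolP/PM.
Qed.

Lemma in_subalg1 : 1 \in in_subalg G.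
Proof. by case: (in_subalg_closed G). Qed.

Lemma in_subalgP a u v :
  u \in in_subalg G -> v \in in_subalg G -> a *: u + v \in in_subalg G.
Proof. by case: (in_subalg_closed G) => _ h _; apply: h. Qed.

Lemma in_subalgM u v : u \in in_subalg G -> v \in in_subalg G -> u * v \in in_subalg G.
Proof. by case: (in_subalg_closed G) => _ _ h; apply: h. Qed.

Lemma in_subalg0 : 0 \in in_subalg G.
Proof. by rewrite -(addNr 1) -scaleN1r; apply: in_subalgP; apply: in_subalg1. Qed.

Lemma in_subalgD u v : u \in in_subalg G -> v \in in_subalg G -> u + v \in in_subalg G.
Proof. by rewrite -[u in u + v]scale1r; apply: in_subalgP. Qed.

Lemma in_subalg_sum I (r : seq I) (P : pred I) (F : I -> A) :
  (forall i, P i -> F i \in in_subalg G) -> \sum_(i <- r | P i) F i \in in_subalg G.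
Proof. by move=> h; elim/big_ind: _ => //; [apply: in_subalg0 | apply: in_subalgD]. Qed.

End SubalgebraTheory.

Lemma in_subalgS (K : comNzRingType) (A : algType K) (G G' : A -> Prop) :
  (forall g, G g -> g \in in_subalg G') -> forall h, h \in in_subalg G -> h \in in_subalg G'.
Proof.
move=> GG'; apply: in_subalg_ind => //; first exact: in_subalg1.
  exact: in_subalgP.
exact: in_subalgM.
Qed.

Section SymmetricAlgebra.
Variables (R : realType) (n : nat) (Phi : root_system R n) (k : 'I_n -> R[i]).
Variable H : graded_hecke Phi k.

Definition sym_gen (h : H) := exists v, h = hecke_x H v.
(** This alias receives the commutative ring structure with which polynomial evaluation [poly_sym]
    is a ring morphism. *)
Definition hecke_sym : Type := subalg sym_gen.
HB.instance Definition _ := GRing.Algebra.on hecke_sym.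

Lemma hecke_xC v v' : hecke_x H v * hecke_x H v' = hecke_x H v' * hecke_x H v.
Proof. by have [_ _ h _] := hecke_rel H; apply: h. Qed.

Fact hecke_sym_mulC : commutative (@GRing.mul hecke_sym).
Proof.
have h1 v : forall h, h \in in_subalg sym_gen -> h * hecke_x H v = hecke_x H v * h.
  apply: in_subalg_ind => [|a u w hu hw|u w hu hw|_ [v' ->]].
  - by rewrite mul1r mulr1.
  - by rewrite mulrDl mulrDr -scalerAl -scalerAr hu hw.
  - by rewrite -mulrA hw mulrA hu mulrA.
  - exact: hecke_xC.
move=> a b; apply: val_inj; move: (valP b).
change (\val b \in in_subalg sym_gen -> \val a * \val b = \val b * \val a).
move: (\val b); apply: in_subalg_ind => [|c u w hu hw|u w hu hw|_ [v ->]].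
- by rewrite mul1r mulr1.
- by rewrite mulrDl mulrDr -scalerAl -scalerAr hu hw.
- by rewrite mulrA hu -mulrA hw mulrA.
- exact: h1 (valP a).
Qed.

HB.instance Definition _ :=
  GRing.PzSemiRing_hasCommutativeMul.Build hecke_sym hecke_sym_mulC.

Lemma sym_gen_x v : sym_gen (hecke_x H v).
Proof. by exists v. Qed.

Definition sym_x v : hecke_sym := subalg_gen (sym_gen_x v).

Local Notation P := {mpoly R[i][n]}.

Definition poly_sym : {rmorphism P -> hecke_sym} :=
  mmap (GRing.in_alg hecke_sym) (fun j => sym_x (delta_mx j 0)).

Definition hecke_poly : {rmorphism P -> H} :=
  ((@subalg_val _ _ sym_gen : {rmorphism hecke_sym -> H}) \o poly_sym)%FUN.

Lemma hecke_poly_sym p : hecke_poly p \in in_subalg sym_gen.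
Proof. exact: subalg_valP. Qed.

Lemma hecke_polyZ c p : hecke_poly (c *: p) = c *: hecke_poly p.
Proof.
rewrite /hecke_poly /poly_sym /= mmapZ /= -scalerAl mul1r.
exact: (linearZ_LR (\val : hecke_sym -> H)).
Qed.

Lemma hecke_polyX m :
  hecke_poly 'X_[m] = \prod_(j < n) hecke_x H (delta_mx j 0) ^+ m j.
Proof.
rewrite /hecke_poly /= /poly_sym /= mmapX /mmap1 rmorph_prod.
by apply: eq_bigr => j _; rewrite rmorphXn.
Qed.

Definition lin_poly (v : 'cV[R[i]]_n) : P := \sum_j v j 0 *: 'X_[U_(j)].

Lemma hecke_poly_lin v : hecke_poly (lin_poly v) = hecke_x H v.
Proof.
have ev : v = \sum_j v j 0 *: delta_mx j 0.
  by rewrite {1}(matrix_sum_delta v); apply: eq_bigr => j _; rewrite big_ord1.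
rewrite [in RHS]ev linear_sum /lin_poly rmorph_sum; apply: eq_bigr => j _.
rewrite hecke_polyZ linearZ; congr (_ *: _).
by rewrite /hecke_poly /= /poly_sym /= mmapX mmap1U.
Qed.

Lemma hecke_poly_eq0 p : hecke_poly p = 0 -> p = 0.
Proof.
move=> hp; apply/eqP; rewrite -msupp_eq0; apply/eqP.
case e : (msupp p) => [//|m r].
pose F (m : 'X_{1..n}) : {ffun 'I_n -> nat} := [ffun j => m j].
pose G (f : {ffun 'I_n -> nat}) : 'X_{1..n} := [multinom f j | j < n].
have FK m' : G (F m') = m' by apply/mnmP => j; rewrite /G /F multinomE tnth_mktuple ffunE.
have := @hecke_SV _ _ _ _ H (map F (msupp p)) (fun f => p@_(G f)).
rewrite map_inj_uniq ?msupp_uniq; last exact: can_inj FK.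
move=> /(_ isT (fun _ _ => I)); rewrite big_map => h.
have mp : m \in msupp p by rewrite e mem_head.
have : p@_m = 0.
  rewrite -[m in p@_m]FK; apply: h; last by rewrite map_f.
  rewrite -[RHS]hp [in RHS](mpolyE p) rmorph_sum; apply: eq_bigr => m' _.
  rewrite hecke_polyZ hecke_polyX FK; congr (_ *: _).
  by apply: eq_bigr => j _; rewrite ffunE.
by move/eqP; rewrite -[_ == 0]negbK -mcoeff_msupp mp.
Qed.

End SymmetricAlgebra.

Section PBW.
Variables (R : realType) (n : nat) (Phi : root_system R n) (k : 'I_n -> R[i]).
Variable H : graded_hecke Phi k.

Local Notation C := R[i].
Local Notation P := {mpoly C[n]}.
Local Notation cmx := (map_mx (real_complex R)).
Local Notation t := (hecke_t H).
Local Notation x := (hecke_x H).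
Local Notation iota := (hecke_poly H).
Local Notation al := (simple Phi).
Local Notation cor := (scoroot Phi).
Local Notation s i := (Defs.refl Phi (simple Phi i)).
Local Notation wmx := (wmx Phi).
Implicit Types (i j : 'I_n) (v : 'cV[C]_n) (w : 'M[R]_n) (q : seq 'I_n).

Lemma cmx_inj : injective (fun w : 'M[R]_n => cmx w).
Proof. by apply: map_mx_inj; apply: fmorph_inj. Qed.

Lemma hecke_t1 : t 1%:M = 1.
Proof. by case: (hecke_rel H). Qed.

Lemma hecke_tM w w' : weyl Phi w -> weyl Phi w' -> t (w *m w') = t w * t w'.
Proof. by case: (hecke_rel H) => _ h _ _; apply: h. Qed.

Lemma cmx_refl_simpleE i v :
  cmx (s i) *m v = v - pairing (cmx (cor i)) v *: cmx (al i).
Proof.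
rewrite /Defs.refl map_mxB map_mx1 map_mxM mulmxBl mul1mx -mulmxA; congr (_ - _).
by rewrite [X in _ *m X]mx11_scalar mul_mx_scalar.
Qed.

Lemma cmx_refl_simpleK i v : cmx (s i) *m (cmx (s i) *m v) = v.
Proof. by rewrite mulmxA -map_mxM refl_simpleK map_mx1 mul1mx. Qed.

Lemma pairing_cmx (g : 'rV[R]_n) (u : 'cV[R]_n) :
  pairing (cmx g) (cmx u) = (pairing g u)%:C%C.
Proof. by rewrite /pairing -map_mxM mxE. Qed.

Lemma pairing_cor_refl i v :
  pairing (cmx (cor i)) (cmx (s i) *m v) = - pairing (cmx (cor i)) v.
Proof.
rewrite cmx_refl_simpleE pairingBr pairingZr pairing_cmx scorootK.
by rewrite rmorph_nat mulr_natr mulr2n opprD addrA subrr sub0r.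
Qed.

Lemma hecke_xt i v : x v * t (s i) =
  t (s i) * x (cmx (s i) *m v) + (k i * pairing (cmx (cor i)) v)%:A.
Proof.
case: (hecke_rel H) => _ _ _ /(_ i (cmx (s i) *m v)); rewrite cmx_refl_simpleK.
rewrite -/(pairing _ _) pairing_cor_refl mulrN scaleNr => /eqP.
by rewrite subr_eq addrC -subr_eq opprK => /eqP <-.
Qed.

Lemma hecke_poly_xC v p : x v * iota p = iota p * x v.
Proof. by rewrite -hecke_poly_lin -!rmorphM mulrC. Qed.

Definition intertwiner i : H := t (s i) * x (cmx (al i)) - (k i)%:A.
Definition intertwiners q : H := foldr (fun i h => intertwiner i * h) 1 q.

(** The term [k i] in the intertwiner is what absorbs the scalar correction of the cross
    relation. *)
Lemma hecke_x_intertwiner i v :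
  x v * intertwiner i = intertwiner i * x (cmx (s i) *m v).
Proof.
have hy : x (cmx (s i) *m v) = x v - pairing (cmx (cor i)) v *: x (cmx (al i)).
  by rewrite cmx_refl_simpleE linearB linearZ.
rewrite /intertwiner mulrBr mulrA hecke_xt mulrDl mulrBl -!mulrA.
rewrite [x (cmx (al i)) * x _]hecke_xC -addrA; congr (_ + _).
rewrite {}hy -scalerAl -scalerAl mul1r -scalerAr mulr1 mul1r scalerBr opprB scalerA.
by [].
Qed.

Lemma intertwiner_sqr i : intertwiner i * intertwiner i =
  (k i ^+ 2)%:A - x (cmx (al i)) ^+ 2.
Proof.
have hx : x (cmx (al i)) * t (s i) = - (t (s i) * x (cmx (al i))) + (k i * 2)%:A.
  rewrite hecke_xt -map_mxM refl_simpleN map_mxN linearN mulrN; congr (_ + _%:A).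
  by rewrite pairing_cmx scorootK rmorph_nat.
have ht : t (s i) * t (s i) = 1.
  by rewrite -hecke_tM ?refl_simpleK ?hecke_t1 //; apply: weyl_simple.
rewrite {1}/intertwiner mulrBl {1}/intertwiner mulrBr.
rewrite mulrA -[t _ * _ * t _]mulrA hx mulrDr mulrDl mulrN mulrA ht mul1r mulNr.
rewrite /intertwiner !mulrBr -!scalerAr -!scalerAl !mulr1 !mul1r.
rewrite [k i * 2]mulrC -scalerA scaler_nat.
rewrite -expr2 scalerA -expr2 mulr2n opprB [- _ + (_ + _)]addrA addrK addrACA subrr addr0.
exact: addrC.
Qed.

Lemma hecke_x_intertwiners q v :
  x v * intertwiners q = intertwiners q * x (cmx (invmx (wmx q)) *m v).
Proof.
elim: q v => [|i q IH] v /=; first by rewrite invmx1 map_mx1 mul1mx mul1r mulr1.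
rewrite mulrA hecke_x_intertwiner -!mulrA IH; congr (_ * (_ * x _)).
rewrite invmxM ?(weyl_unit (weyl_simple _ _)) ?(weyl_unit (weyl_wmx _ _)) //.
by rewrite invmx_refl ?simple_root // map_mxM mulmxA.
Qed.

Lemma lin_poly_neqC v (c : C) : v != 0 -> lin_poly v != c%:MP_[n].
Proof.
apply: contra => /eqP h; apply/eqP/colP => j; rewrite mxE.
have := congr1 (mcoeff U_(j)) h; rewrite mcoeffC mnm1_eq0 mulr0.
rewrite /lin_poly linear_sum /= (bigD1 j) //= mcoeffZ mcoeffX eqxx mulr1.
by rewrite big1 ?addr0 // => l lj; rewrite mcoeffZ mcoeffX eq_mnm1 (negPf lj) mulr0.
Qed.

(** Multiplying by the first intertwiner again makes it a square, k^2 - alpha^2, which passes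
    through the rest as k^2 - (w^-1 alpha)^2 = (k - w^-1 alpha)(k + w^-1 alpha). Neither factor is
    zero, and polynomials form a domain. *)
Lemma intertwiners_eq0 q p : intertwiners q * iota p = 0 -> p = 0.
Proof.
elim: q p => [|i q IH] p /=; first by rewrite mul1r; apply: hecke_poly_eq0.
rewrite -mulrA => /(congr1 (fun h => intertwiner i * h)).
rewrite mulr0 mulrA intertwiner_sqr mulrBl.
set v := cmx (invmx (wmx q)) *m cmx (al i).
have hx u : x (cmx (al i)) * (intertwiners q * u) = intertwiners q * (x v * u).
  by rewrite mulrA hecke_x_intertwiners -mulrA.
have -> : x (cmx (al i)) ^+ 2 * (intertwiners q * iota p) =
    intertwiners q * iota (lin_poly v ^+ 2 * p).
  by rewrite rmorphM rmorphXn hecke_poly_lin !expr2 -!mulrA !hx.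
rewrite -scalerAl mul1r scalerAr -hecke_polyZ -mulrBr -rmorphB => /IH.
rewrite -mul_mpolyC -mulrBl => /eqP; rewrite mulf_eq0 => /orP [|/eqP //].
have v0 : v != 0.
  apply: contraNneq (simple_neq0 Phi i) => /(congr1 (mulmx (cmx (wmx q)))).
  rewrite mulmx0 mulmxA -map_mxM mulmxV ?(weyl_unit (weyl_wmx _ _)) // map_mx1 mul1mx.
  by rewrite -(map_mx0 (real_complex R)) => /map_mx_inj ->.
rewrite rmorphXn /= subr_sqr mulf_eq0 subr_eq0 eq_sym (negPf (lin_poly_neqC _ v0)).
by rewrite addrC addr_eq0 -rmorphN /= (negPf (lin_poly_neqC _ v0)).
Qed.


End PBW.

(** * The [t w] as a basis over the polynomials *)

Section Basis.
Variables (R : realType) (n : nat) (Phi : root_system R n) (k : 'I_n -> R[i]).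
Variable H : graded_hecke Phi k.

Local Notation C := R[i].
Local Notation P := {mpoly C[n]}.
Local Notation cmx := (map_mx (real_complex R)).
Local Notation t := (hecke_t H).
Local Notation x := (hecke_x H).
Local Notation iota := (hecke_poly H).
Local Notation s i := (Defs.refl Phi (simple Phi i)).
Local Notation wmx := (wmx Phi).
Local Notation W := (weyl_enum Phi).
Local Notation m := (size (weyl_enum Phi)).
Implicit Types (i j : 'I_m) (v : 'cV[C]_n) (w : 'M[R]_n) (J : {set 'I_n}).

Definition weyl_nth i : 'M[R]_n := nth 1%:M W i.

Lemma weyl_nth_weyl i : weyl Phi (weyl_nth i).
Proof. by apply/weyl_enumP/mem_nth. Qed.

Lemma weyl_nth_inj : injective weyl_nth.
Proof.
by move=> i j /eqP; rewrite nth_uniq ?weyl_enum_uniq // => /eqP/val_inj.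
Qed.

Lemma weyl_nthP w : weyl Phi w -> exists i, weyl_nth i = w.
Proof.
move/weyl_enumP => hw; have hi := hw; rewrite -index_mem in hi.
by exists (Ordinal hi); rewrite /weyl_nth nth_index.
Qed.

(** Coordinates are indexed by the whole group and vanish off [W_J], so that one uniqueness
    statement covers every [J]. *)
Definition parab_span J (h : H) : Prop := exists2 p : 'I_m -> P,
  forall i, ~ weyl_parab Phi J (weyl_nth i) -> p i = 0 &
  h = \sum_i t (weyl_nth i) * iota (p i).

Lemma parab_spanP J a g h :
  parab_span J g -> parab_span J h -> parab_span J (a *: g + h).
Proof.
move=> [p hp ->] [p' hp' ->]; exists (fun i => a *: p i + p' i).
  by move=> i hi; rewrite hp ?hp' // scaler0 addr0.
rewrite scaler_sumr -big_split; apply: eq_bigr => i _.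
by rewrite rmorphD hecke_polyZ mulrDr -scalerAr.
Qed.

Lemma parab_span0 J : parab_span J 0.
Proof.
by exists (fun=> 0) => //; rewrite big1 // => i _; rewrite rmorph0 mulr0.
Qed.

Lemma parab_spanD J g h : parab_span J g -> parab_span J h -> parab_span J (g + h).
Proof. by move=> hg hh; rewrite -[g]scale1r; apply: parab_spanP. Qed.

Lemma parab_spanZ J a g : parab_span J g -> parab_span J (a *: g).
Proof. by move=> hg; rewrite -[_ *: _]addr0; apply: parab_spanP (parab_span0 J). Qed.

Lemma parab_span_sum J I (r : seq I) (Q : pred I) (F : I -> H) :
  (forall z, Q z -> parab_span J (F z)) -> parab_span J (\sum_(i <- r | Q i) F i).
Proof. by move=> h; elim/big_ind: _ => //; [apply: parab_span0 | apply: parab_spanD]. Qed.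

Lemma parab_span_t J w p : weyl_parab Phi J w -> parab_span J (t w * iota p).
Proof.
move=> hw; have [i0 wi] := weyl_nthP (weyl_parabW hw).
exists (fun i => if i == i0 then p else 0) => [i|].
  by case: eqP => // ->; rewrite wi.
rewrite (bigD1 i0) //= eqxx wi big1 ?addr0 // => i /negPf ->.
by rewrite rmorph0 mulr0.
Qed.

Lemma parab_span_mult J g h : (forall w p, weyl_parab Phi J w ->
  parab_span J (g * (t w * iota p))) -> parab_span J h -> parab_span J (g * h).
Proof.
move=> hg [p hp ->]; rewrite mulr_sumr; apply: parab_span_sum => i _.
have [wi|wi] := pselect (weyl_parab Phi J (weyl_nth i)); first exact: hg.
by rewrite hp // rmorph0 !mulr0; apply: parab_span0.
Qed.

Lemma parab_span_tl J w h : weyl_parab Phi J w -> parab_span J h -> parab_span J (t w * h).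
Proof.
move=> hw; apply: parab_span_mult => w' p hw'; rewrite mulrA.
rewrite -(hecke_tM H (weyl_parabW hw) (weyl_parabW hw')).
by apply: parab_span_t; apply: weyl_parabM.
Qed.

Lemma parab_span_xl J v h : parab_span J h -> parab_span J (x v * h).
Proof.
apply: parab_span_mult => w p /weyl_parab_word [q hq ->].
elim: q hq v => [_|i q IH /= /andP [iJ hq]] v /=.
  have hJ1 : weyl_parab Phi J 1%:M by apply: refl_group1.
  have := parab_span_t (lin_poly v * p) hJ1.
  by rewrite hecke_t1 !mul1r rmorphM hecke_poly_lin.
have hs : weyl_parab Phi J (s i).
  by rewrite -[s i]mulmx1; apply: (@weyl_parab_wmx _ _ Phi J [:: i]); rewrite /= iJ.
rewrite (hecke_tM H (weyl_parabW hs) (weyl_wmx _ _)).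
rewrite !mulrA hecke_xt !mulrDl -!mulrA; apply: parab_spanD; last first.
  rewrite -scalerAl mul1r; apply/parab_spanZ/parab_span_t.
  exact: weyl_parab_wmx.
by apply: parab_span_tl => //; apply: IH.
Qed.

Lemma lin_poly0 : lin_poly 0 = 0 :> P.
Proof. by rewrite /lin_poly big1 // => i _; rewrite mxE scale0r. Qed.

Lemma parab_span_in_subalg J h : h \in in_subalg (@parab_gen _ _ _ _ H J) ->
  parab_span J h.
Proof.
move=> hJ; suff H1 : forall y, parab_span J y -> parab_span J (h * y).
  rewrite -[h]mulr1; apply: H1.
  have hJ1 : weyl_parab Phi J 1%:M by apply: refl_group1.
  by have := parab_span_t 1 hJ1; rewrite hecke_t1 rmorph1 mulr1.
move: h hJ; apply: in_subalg_ind => [|a u w hu hw|u w hu hw|g hg] y.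
- by rewrite mul1r.
- by move=> hy; rewrite mulrDl -scalerAl; apply: parab_spanP; [apply: hu | apply: hw].
- by move=> hy; rewrite -mulrA; apply/hu/hw.
- by case: hg => [[w hw ->]|[v ->]]; [apply: parab_span_tl | apply: parab_span_xl].
Qed.

Lemma weyl_parabT w : weyl Phi w -> weyl_parab Phi [set: 'I_n] w.
Proof.
move=> /weyl_word [q ->]; apply: weyl_parab_wmx.
by apply/allP => i _; rewrite /= inE.
Qed.

Lemma hecke_span h : exists p : 'I_m -> P, h = \sum_i t (weyl_nth i) * iota (p i).
Proof.
have [|p _ ->] := @parab_span_in_subalg [set: 'I_n] h; last by exists p.
move: (hecke_gen h); apply: in_subalgS => g hg; apply: in_subalg_gen.
by case: hg => [[w hw ->]|[v ->]]; [left; exists w; first exact: weyl_parabT | right; exists v].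
Qed.

(** One word is fixed for each group element; another word may give another element of [H]. *)
Definition weyl_intertwiner i : H :=
  intertwiners H (sval (cid (weyl_word (weyl_nth_weyl i)))).

Lemma hecke_x_weyl_intertwiner i v :
  x v * weyl_intertwiner i = weyl_intertwiner i * x (cmx (invmx (weyl_nth i)) *m v).
Proof. by rewrite /weyl_intertwiner; case: cid => q /= ->; apply: hecke_x_intertwiners. Qed.

(** A shortest relation is trivial: [x v] times it and it times the [x v'] that
    cancels one term give a shorter one. *)
Lemma weyl_intertwiner_free (p : 'I_m -> P) :
  \sum_i weyl_intertwiner i * iota (p i) = 0 -> forall i, p i = 0.
Proof.
have [N] := ubnP #|[pred i | p i != 0]|; elim: N p => // N IH p hN hp.
apply: contrapT => /existsNP [i1 /eqP hi1].
have [[i2 i21 hi2]|h2] := pselect (exists2 i, i != i1 & p i != 0); last first.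
  have p0 i : i != i1 -> p i = 0.
    by move=> hi; apply: contrapT => /eqP hpi; apply: h2; exists i.
  move: hp; rewrite (bigD1 i1) //= big1 ?addr0 => [|i /p0 ->]; last first.
    by rewrite rmorph0 mulr0.
  by rewrite /weyl_intertwiner => /intertwiners_eq0 h; rewrite h eqxx in hi1.
pose Wv i v := cmx (invmx (weyl_nth i)) *m v.
have [v hv] : exists v, Wv i2 v - Wv i1 v != 0.
  apply: contrapT => /forallNP h; case/negP: i21; apply/eqP/weyl_nth_inj.
  apply: (can_inj invmxK); apply: cmx_inj => /=.
  apply: mulmx_ext => v; apply/eqP; rewrite -subr_eq0.
  by apply/negPn/negP; apply: h.
pose p' i := lin_poly (Wv i v - Wv i1 v) * p i.
have : p' i2 = 0.
  apply: IH.
    apply: (@leq_trans #|[pred i | p i != 0]|) => //.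
    apply: proper_card; apply/properP; split.
      apply/fintype.subsetP => i; rewrite !inE /p' mulf_eq0.
      by apply: contra => ->; rewrite orbT.
    by exists i1; rewrite !inE // /p' subrr lin_poly0 mul0r eqxx.
  have /(congr1 (fun h => x v * h - h * x (Wv i1 v))) := hp.
  rewrite mulr0 mul0r subrr => e; rewrite -[RHS]e.
  rewrite mulr_sumr mulr_suml -sumrB; apply: eq_bigr => i _.
  rewrite mulrA hecke_x_weyl_intertwiner -!mulrA -mulrBr; congr (_ * _).
  by rewrite -hecke_poly_xC -mulrBl -linearB -hecke_poly_lin -rmorphM.
move/eqP; rewrite mulf_eq0 (negPf hi2) orbF -[0]mpolyC0.
by rewrite (negPf (lin_poly_neqC _ hv)).
Qed.

(** The base change from the [t w] to the intertwiners is injective, hence its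
    determinant is nonzero. *)
Lemma hecke_free (p : 'I_m -> P) :
  \sum_i t (weyl_nth i) * iota (p i) = 0 -> forall i, p i = 0.
Proof.
move=> hp.
have [A hA] : exists A : 'M[P]_m, forall i,
    weyl_intertwiner i = \sum_j t (weyl_nth j) * iota (A j i).
  have [A hA] := choice (fun i => hecke_span (weyl_intertwiner i)).
  by exists (\matrix_(j, i) A i j) => i; rewrite {1}hA; apply: eq_bigr => j _; rewrite mxE.
have hsum (q : 'cV[P]_m) : \sum_i weyl_intertwiner i * iota (q i 0) =
    \sum_j t (weyl_nth j) * iota ((A *m q) j 0).
  transitivity (\sum_i \sum_j t (weyl_nth j) * iota (A j i * q i 0)).
    apply: eq_bigr => i _; rewrite hA mulr_suml; apply: eq_bigr => j _.
    by rewrite rmorphM mulrA.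
  rewrite exchange_big; apply: eq_bigr => j _.
  by rewrite mxE rmorph_sum mulr_sumr.
(* A nonzero kernel vector of [A] would be a relation between the intertwiners. *)
have dA : \det A != 0.
  rewrite -det_tr; apply/negP => /det0P [q q0 hq]; case/negP: q0; apply/eqP/rowP => i.
  rewrite mxE; have -> : q 0 i = q^T i 0 by rewrite mxE.
  move: i; apply: weyl_intertwiner_free; rewrite hsum.
  have -> : A *m q^T = 0 by rewrite -[A]trmxK -trmx_mul hq trmx0.
  by rewrite big1 // => j _; rewrite mxE rmorph0 mulr0.
(* Applying [A] to the adjugate vector gives [\det A] times [p], so the intertwiners with these
   coefficients sum to the given relation times [\det A], which is zero. *)
have hq : forall i, (\adj A *m \col_i p i) i 0 = 0.
  apply: weyl_intertwiner_free; rewrite hsum mulmxA mul_mx_adj.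
  rewrite [RHS](_ : 0 = (\sum_i t (weyl_nth i) * iota (p i)) * iota (\det A)); last first.
    by rewrite hp mul0r.
  rewrite mulr_suml; apply: eq_bigr => j _.
  by rewrite mul_scalar_mx !mxE mulrC rmorphM mulrA.
move=> i; have : (A *m (\adj A *m \col_i p i)) i 0 = 0.
  by rewrite (_ : \adj A *m _ = 0) ?mulmx0 ?mxE //; apply/colP => j; rewrite hq mxE.
rewrite mulmxA mul_mx_adj mul_scalar_mx !mxE => /eqP.
by rewrite mulf_eq0 (negPf dA) => /eqP.
Qed.

Definition hecke_coord (i : 'I_m) (h : H) : P := sval (cid (hecke_span h)) i.

Lemma hecke_coordE h : h = \sum_i t (weyl_nth i) * iota (hecke_coord i h).
Proof. by rewrite {1}(svalP (cid (hecke_span h))). Qed.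

Lemma hecke_coord_uniq (p : 'I_m -> P) h :
  h = \sum_i t (weyl_nth i) * iota (p i) -> forall i, hecke_coord i h = p i.
Proof.
move=> hp i; apply/eqP; rewrite -subr_eq0; apply/eqP; move: i.
apply: hecke_free; under eq_bigr do rewrite rmorphB mulrBr.
by rewrite sumrB -hecke_coordE -hp subrr.
Qed.

Lemma hecke_coordD i g h : hecke_coord i (g + h) = hecke_coord i g + hecke_coord i h.
Proof.
apply: (hecke_coord_uniq (p := fun i => hecke_coord i g + hecke_coord i h)).
rewrite {1}(hecke_coordE g) {1}(hecke_coordE h) -big_split.
by apply: eq_bigr => j _; rewrite rmorphD mulrDr.
Qed.

Lemma hecke_coord_t i j p :
  hecke_coord i (t (weyl_nth j) * iota p) = if i == j then p else 0.
Proof.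
apply: (hecke_coord_uniq (p := fun i => if i == j then p else 0)).
rewrite (bigD1 j) //= eqxx big1 ?addr0 // => l /negPf ->.
by rewrite rmorph0 mulr0.
Qed.

End Basis.

(** * Right projectivity over a parabolic subalgebra *)

Section Induction.
Variables (R : realType) (n : nat) (Phi : root_system R n) (k : 'I_n -> R[i]).
Variables (H : graded_hecke Phi k) (J : {set 'I_n}).

Local Notation C := R[i].
Local Notation P := {mpoly C[n]}.
Local Notation t := (hecke_t H).
Local Notation x := (hecke_x H).
Local Notation iota := (hecke_poly H).
Local Notation W := (weyl_enum Phi).
Local Notation m := (size (weyl_enum Phi)).
Local Notation Wn := (@weyl_nth _ _ Phi).
Local Notation PJ := (in_subalg (@parab_gen _ _ _ _ H J)).
Implicit Types (i j : 'I_m) (w u : 'M[R]_n) (h : H).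

Lemma hecke_t_parab w : weyl_parab Phi J w -> t w \in PJ.
Proof. by move=> hw; apply: in_subalg_gen; left; exists w. Qed.

Lemma hecke_poly_parab p : iota p \in PJ.
Proof.
apply: in_subalgS (hecke_poly_sym H p) => _ [v ->].
by apply: in_subalg_gen; right; exists v.
Qed.

(** The first element of the enumeration in [w W_J]: constant on the coset, but not necessarily its
    shortest element. *)
Definition coset_rep w : 'M[R]_n :=
  nth 1%:M W (find (fun r => `[< weyl_parab Phi J (invmx w *m r) >]) W).

Lemma coset_repP w : weyl Phi w ->
  weyl Phi (coset_rep w) /\ weyl_parab Phi J (invmx w *m coset_rep w).
Proof.
move=> hw; pose a := fun r => `[< weyl_parab Phi J (invmx w *m r) >].
have ha : has a W.
  apply/hasP; exists w; first exact/weyl_enumP.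
  by apply/asboolP; rewrite mulVmx ?(weyl_unit hw) //; apply: refl_group1.
split; last by have /asboolP := nth_find 1%:M ha.
by apply/weyl_enumP; rewrite mem_nth // -has_find.
Qed.

Lemma coset_repM w u : weyl Phi w -> weyl_parab Phi J u ->
  coset_rep (w *m u) = coset_rep w.
Proof.
move=> hw hu; rewrite /coset_rep; congr (nth _ _ _); apply: eq_find => r.
have uw := weyl_unit hw; have uu := weyl_unit (weyl_parabW hu).
apply: asbool_equiv_eq; rewrite invmxM // -mulmxA; split => h.
  by rewrite -(mulKVmx uu (invmx w *m r)); apply: weyl_parabM.
by apply: weyl_parabM => //; apply: weyl_parabV.
Qed.

(** The part of [h] supported on the coset represented by [Wn i], divided on the left by [t (Wn i)].
    It is zero when [Wn i] is not a [coset_rep], so indexing by the whole group adds nothing. *)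
Definition coset_coordH i h : H :=
  \sum_(j | coset_rep (Wn j) == Wn i)
    t (invmx (Wn i) *m Wn j) * iota (hecke_coord j h).

Lemma coset_coordH_parab i h : coset_coordH i h \in PJ.
Proof.
apply: in_subalg_sum => j /eqP hj; apply: in_subalgM; last exact: hecke_poly_parab.
apply: hecke_t_parab; rewrite -hj.
have [h1 h2] := coset_repP (weyl_nth_weyl j).
rewrite -[X in _ *m X]invmxK -invmxM ?unitmx_inv ?(weyl_unit h1) //.
  exact: weyl_parabV.
exact: weyl_unit (weyl_nth_weyl j).
Qed.

Definition coset_coord i h : parab H J := Subalg (coset_coordH_parab i h).

Lemma coset_coordHD i g h : coset_coordH i (g + h) = coset_coordH i g + coset_coordH i h.
Proof.
rewrite /coset_coordH -big_split; apply: eq_bigr => j _.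
by rewrite hecke_coordD rmorphD mulrDr.
Qed.

Lemma coset_coordH0 i : coset_coordH i 0 = 0.
Proof. by apply: (addrI (coset_coordH i 0)); rewrite -coset_coordHD !addr0. Qed.

Lemma coset_coordH_sum i I (r : seq I) (Q : pred I) (F : I -> H) :
  coset_coordH i (\sum_(z <- r | Q z) F z) = \sum_(z <- r | Q z) coset_coordH i (F z).
Proof.
exact: (big_morph (coset_coordH i) (coset_coordHD i) (coset_coordH0 i)).
Qed.

Lemma coset_coordH_t i w p : weyl Phi w -> coset_coordH i (t w * iota p) =
  if coset_rep w == Wn i then t (invmx (Wn i) *m w) * iota p else 0.
Proof.
move=> /(@weyl_nthP _ _ Phi) [j <-]; rewrite /coset_coordH.
transitivity (\sum_(l | coset_rep (Wn l) == Wn i)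
    if l == j then t (invmx (Wn i) *m Wn j) * iota p else 0).
  apply: eq_bigr => l _; rewrite hecke_coord_t; case: eqP => [->|_] //.
  by rewrite rmorph0 mulr0.
by rewrite big_mkcond (bigD1 j) //= eqxx big1 ?addr0 // => l /negPf ->; rewrite if_same.
Qed.

Lemma hecke_dual_basis :
  right_dual_basis (parab_incl H J) (fun i => t (Wn i)) coset_coord.
Proof.
split=> [i g h|i h a|h].
- by apply: val_inj; rewrite rmorphD /= coset_coordHD.
- apply: val_inj; rewrite rmorphM /=; move: (subalg_valP a) => /=.
  rewrite /parab_incl; move: (subalg_val a) => {}a ha.
  rewrite [in LHS](hecke_coordE h) [in RHS](hecke_coordE h) mulr_suml !coset_coordH_sum.
  rewrite mulr_suml; apply: eq_bigr => j _; move: (hecke_coord j h) => p.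
  have hj := weyl_nth_weyl j.
  (* The product lies in [H_J], so only [t (Wn l)] with [Wn l] in [W_J] occur, and these preserve
     the coset of [Wn j]. *)
  have [q hq eq] := parab_span_in_subalg (in_subalgM (hecke_poly_parab p) ha).
  rewrite coset_coordH_t // -mulrA eq mulr_sumr coset_coordH_sum.
  transitivity (\sum_l if coset_rep (Wn j) == Wn i then
      t (invmx (Wn i) *m Wn j) * (t (Wn l) * iota (q l)) else 0).
    apply: eq_bigr => l _.
    have [hl|hl] := pselect (weyl_parab Phi J (Wn l)); last first.
      by rewrite hq // rmorph0 !mulr0 if_same coset_coordH0.
    have hl' := weyl_parabW hl.
    rewrite [t (Wn j) * _]mulrA -(hecke_tM H hj hl') coset_coordH_t; last exact: weylM.
    rewrite coset_repM //; case: eqP => // hr.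
    have hij := weylM (weylV (weyl_nth_weyl i)) hj.
    by rewrite mulrA mulmxA (hecke_tM H hij hl').
  case: eqP => _; last by rewrite big1 ?mul0r // => l _.
  by rewrite -mulr_sumr -eq mulrA.
- rewrite [LHS]hecke_coordE.
  transitivity (\sum_i \sum_(j | coset_rep (Wn j) == Wn i) t (Wn j) * iota (hecke_coord j h)).
    rewrite (exchange_big_dep xpredT) //=; apply: eq_bigr => j _.
    have [hr _] := coset_repP (weyl_nth_weyl j); have [i hi] := @weyl_nthP _ _ Phi _ hr.
    rewrite (big_pred1 i) // => l /=; rewrite -hi.
    by apply/eqP/eqP => [/weyl_nth_inj //|->].
  apply: eq_bigr => i _; rewrite /= /coset_coordH mulr_sumr; apply: eq_bigr => j _.
  have hi := weyl_nth_weyl i; have hij := weylM (weylV hi) (weyl_nth_weyl j).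
  by rewrite mulrA -(hecke_tM H hi hij) mulKVmx // (weyl_unit hi).
Qed.

End Induction.

(** * Weights of standard modules *)

Section Filtration.
Variables (R : realType) (n : nat) (Phi : root_system R n) (k : 'I_n -> R[i]).
Variables (H : graded_hecke Phi k) (J : {set 'I_n}).

Local Notation C := R[i].
Local Notation cmx := (map_mx (real_complex R)).
Local Notation t := (hecke_t H).
Local Notation x := (hecke_x H).
Local Notation s i := (Defs.refl Phi (simple Phi i)).
Local Notation wmx := (wmx Phi).
Local Notation PJ := (in_subalg (@parab_gen _ _ _ _ H J)).
Implicit Types (w : 'M[R]_n) (h : H) (q : seq 'I_n).

(** The sum of the [t w H_J] for the [w] of length less than [l] that are
    shortest in [w W_J]. *)
Inductive coset_filt (l : nat) : H -> Prop :=
| coset_filt0 : coset_filt l 0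
| coset_filtD g h : coset_filt l g -> coset_filt l h -> coset_filt l (g + h)
| coset_filt_gen q a : coset_min Phi J (wmx q) -> (size q < l)%N -> a \in PJ ->
    coset_filt l (t (wmx q) * a).

Lemma coset_filtW l l' h : (l <= l')%N -> coset_filt l h -> coset_filt l' h.
Proof.
move=> ll'; elim=> {h} [|g h _ IHg _ IHh|q a hq sq ha]; first exact: coset_filt0.
  exact: coset_filtD.
by apply: coset_filt_gen => //; apply: leq_trans ll'.
Qed.

Lemma coset_filtMr l h a : coset_filt l h -> a \in PJ -> coset_filt l (h * a).
Proof.
move=> hl ha; elim: hl => {h} [|g h _ IHg _ IHh|q b hq sq hb].
- by rewrite mul0r; apply: coset_filt0.
- by rewrite mulrDl; apply: coset_filtD.
- by rewrite -mulrA; apply: coset_filt_gen => //; apply: in_subalgM.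
Qed.

Lemma hecke_x_parab v : x v \in PJ.
Proof. by apply: in_subalg_gen; right; exists v. Qed.

Lemma scalar_parab c : c%:A \in PJ.
Proof.
by rewrite -[_%:A]addr0; apply: in_subalgP; [exact: in_subalg1 | exact: in_subalg0].
Qed.

Lemma coset_filtZ l c h : coset_filt l h -> coset_filt l (c%:A * h).
Proof. by move=> hl; rewrite scalar_comm; apply: coset_filtMr => //; apply: scalar_parab. Qed.

(** Either [s i *m w] is again shortest in its coset, or it equals [w *m s j] with [j] in [J] and
    [t (s j)] is absorbed on the right. *)
Lemma coset_filt_t l i h : coset_filt l h -> coset_filt l.+1 (t (s i) * h).
Proof.
elim=> {h} [|g h _ IHg _ IHh|q a hq sq ha].
- by rewrite mulr0; apply: coset_filt0.
- by rewrite mulrDr; apply: coset_filtD.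
- rewrite mulrA -hecke_tM; [|exact: weyl_simple|exact: weyl_wmx].
  have [hi|/(coset_min_simple hq) [j jJ ->]] := pselect (coset_min Phi J (s i *m wmx q)).
    exact: (@coset_filt_gen _ (i :: q)).
  rewrite hecke_tM; [|exact: weyl_wmx|exact: weyl_simple].
  rewrite -mulrA; apply: coset_filt_gen => //; first exact: ltnW.
  apply: in_subalgM => //; apply: hecke_t_parab.
  by have := @weyl_parab_wmx _ _ Phi J [:: j]; rewrite /= jJ mulmx1; apply.
Qed.

Lemma hecke_xt_coset q v : coset_min Phi J (wmx q) ->
  coset_filt (size q)
    (x v * t (wmx q) - t (wmx q) * x (cmx (invmx (wmx q)) *m v)).
Proof.
have [N] := ubnP (size q); elim: N q v => // N IH [v _ _|i q v /= hN hw].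
  by rewrite /= hecke_t1 invmx1 map_mx1 mul1mx mul1r mulr1 subrr; apply: coset_filt0.
(* An unreduced word may have a tail that is not shortest in its coset; it is replaced by a shorter
   word for the same element. *)
have [h0|h0] := pselect (coset_min Phi J (wmx q)); last first.
  have [q' sq' e] := coset_min_pred hw h0.
  rewrite e in hw *; apply: coset_filtW (IH q' v _ hw); last exact: leq_trans sq' (ltnW hN).
  exact: leq_trans (ltnW sq') (leqnSn _).
rewrite hecke_tM; [|exact: weyl_simple|exact: weyl_wmx].
rewrite mulrA hecke_xt mulrDl invmxM ?(weyl_unit (weyl_wmx _ _)) //; last first.
  exact: weyl_unit (weyl_simple _ _).
rewrite invmx_refl ?simple_root // map_mxM -mulmxA addrAC -!mulrA -mulrBr.
apply: coset_filtD; first by apply: coset_filt_t; apply: IH.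
apply: coset_filtZ; rewrite -[t _]mulr1; apply: coset_filt_gen => //.
exact: in_subalg1.
Qed.

Lemma coset_filt_x l v h : coset_filt l h -> coset_filt l (x v * h).
Proof.
elim=> {h} [|g h _ IHg _ IHh|q a hq sq ha].
- by rewrite mulr0; apply: coset_filt0.
- by rewrite mulrDr; apply: coset_filtD.
- rewrite mulrA -[x v * _](subrK (t (wmx q) * x (cmx (invmx (wmx q)) *m v))) mulrDl.
  apply: coset_filtD.
    by apply: coset_filtMr => //; apply: (coset_filtW (ltnW sq)); apply: hecke_xt_coset.
  rewrite -mulrA; apply: coset_filt_gen => //.
  by apply: in_subalgM => //; apply: hecke_x_parab.
Qed.

Lemma coset_filt_exhaust : exists L, forall h, coset_filt L h.
Proof.
pose word i := sval (cid (weyl_word (@weyl_nth_weyl _ _ Phi i))).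
have wordE i : weyl_nth i = wmx (word i) by rewrite /word; case: cid.
pose L := (\max_i size (word i)).+1.
(* Any word can be exchanged for the chosen word of its element, so the filtration stops at [L];
   this layer then contains 1 and is stable under the generators. *)
have top l h : coset_filt l h -> coset_filt L h.
  elim=> {h} [|g h _ IHg _ IHh|q a hq _ ha]; first exact: coset_filt0.
    exact: coset_filtD.
  have [i hi] := weyl_nthP (weyl_wmx Phi q); rewrite -hi in hq *.
  rewrite wordE in hq *; apply: coset_filt_gen => //.
  by rewrite ltnS; apply: (leq_bigmax_cond (F := fun i => size (word i))).
exists L => h; suff h1 y : coset_filt L y -> coset_filt L (h * y).
  rewrite -[h]mulr1; apply: h1; rewrite -[1]mulr1 -{1}(hecke_t1 H).
  apply: (@coset_filt_gen _ [::]) => //; first exact: coset_min1.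
  exact: in_subalg1.
move: h (hecke_gen h) y; apply: in_subalg_ind => [|c g h hg hh|g h hg hh|g hg] y hy.
- by rewrite mul1r.
- rewrite mulrDl (_ : c *: g * y = c%:A * (g * y)); last by rewrite -!scalerAl mul1r.
  by apply: coset_filtD; [apply/coset_filtZ/hg | apply: hh].
- by rewrite -mulrA; apply/hg/hh.
case: hg => [[w hw ->]|[v ->]]; last exact: coset_filt_x.
have [q ->] := weyl_word hw; elim: q => [|i q IH] /=; first by rewrite hecke_t1 mul1r.
rewrite hecke_tM; [|exact: weyl_simple|exact: weyl_wmx].
by rewrite -mulrA; apply: (top L.+1); apply: coset_filt_t.
Qed.

Lemma parab_x_linear : linear (@parab_x _ _ _ _ H J).
Proof. by move=> c u v; apply: val_inj; rewrite /= linearP. Qed.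

HB.instance Definition _ :=
  GRing.isLinear.Build C 'cV[C]_n (parab H J) *:%R (@parab_x _ _ _ _ H J) parab_x_linear.

Variables (U : lmodType (parab H J)) (D : seq 'rV[C]_n).
Hypothesis UD : forall u : U, killed (@parab_x _ _ _ _ H J) D u.

Local Notation tens := (tens (parab_incl H J)).

(** [x v] acts on [t w (x) U] as [w^-1 v] acts on [U], up to lower terms. *)
Lemma standard_killed_filt l : exists E,
  (forall g, g \in E -> exists g' w,
     [/\ g' \in D, coset_min Phi J w & g = g' *m cmx (invmx w)]) /\
  (forall h (u : U), coset_filt l h -> killed x E (tens h u)).
Proof.
elim: l => [|l [E [hE EU]]].
  exists [::]; split=> // h u; elim=> {h} [|g h _ IHg _ IHh|//].
    by rewrite tens0l.
  by rewrite tensDl IHg IHh addr0.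
(* The twisted weights contributed by the layer of [w]; the list [E] disposes of what falls into
   shorter layers. *)
pose F w := if `[< coset_min Phi J w >] then [seq g *m cmx (invmx w) | g <- D] else [::].
exists (flatten [seq F w | w <- weyl_enum Phi] ++ E); split=> [g|h u].
  rewrite mem_cat => /orP [/flatten_mapP [w _]|/hE //].
  by rewrite /F; case: asboolP => // hw /mapP [g' g'D ->]; exists g', w.
elim=> {h} [|g h _ IHg _ IHh|q a hq sq ha]; first by rewrite tens0l; apply: killed0.
  by rewrite tensDl; apply: killedD.
rewrite -[a]/(parab_incl H J (Subalg ha)) tens_balanced.
move: (_ *: u) => {a ha} u.
have hflat y : killed x (F (wmx q) ++ E) y ->
    killed x (flatten [seq F w | w <- weyl_enum Phi] ++ E) y.
  have /weyl_enumP := weyl_wmx Phi q; elim: (weyl_enum Phi) => //= w r IH.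
  rewrite inE => /orP [/eqP <- h|hr h].
    have {}h := killed_catr (hecke_xC H) (flatten [seq F w | w <- r]) h.
    by rewrite -catA; apply: (killed_perm (hecke_xC H)) h; apply: permEl (perm_catCA _ _ _).
  by rewrite -catA; apply: killed_catr; [apply: hecke_xC | apply: IH].
apply: hflat; rewrite /F; case: asboolP => // _.
elim: D u (UD u) => [|g D' IH] u /=; first by move=> ->; rewrite tens0r; apply: killed0.
move=> hu v.
(* [f] is the error of commuting [x v] past [t w]; it lies in a lower layer, hence is killed by
   [E]. *)
pose w := wmx q; pose f := x v * t w - t w * x (cmx (invmx w) *m v).
have -> : shift x (g *m cmx (invmx w)) v *: tens (t w) u =
    tens (t w) (shift (@parab_x _ _ _ _ H J) g (cmx (invmx w) *m v) *: u) + tens f u.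
  rewrite -tens_balanced -tensDl tensZ; congr (tens _ u).
  rewrite /shift /f rmorphB /= pairingM mulrBl mulrBr.
  by rewrite -scalerAl mul1r -scalerAr mulr1 [RHS]addrC addrA subrK.
apply: killedD; first exact: IH.
apply: killed_catr; first exact: hecke_xC.
by apply: EU; apply: coset_filtW (hecke_xt_coset v hq).
Qed.

End Filtration.

Section Weights.
Variables (R : realType) (n : nat) (Phi : root_system R n) (k : 'I_n -> R[i]).
Variables (H : graded_hecke Phi k) (J : {set 'I_n}) (U : lmodType (parab H J)).

Local Notation C := R[i].
Local Notation cmx := (map_mx (real_complex R)).
Local Notation t := (hecke_t H).
Local Notation x := (hecke_x H).
Local Notation px := (@parab_x _ _ _ _ H J).

Lemma parab_xC v v' : px v * px v' = px v' * px v.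
Proof. by apply: val_inj; rewrite !rmorphM /=; apply: hecke_xC. Qed.

(** For such [v] the reflections of [J] fix [v] and the cross relations lose their scalar term. *)
Lemma parab_x_central v : (forall i, i \in J -> pairing (cmx (scoroot Phi i)) v = 0) ->
  forall a : parab H J, GRing.comm (px v) a.
Proof.
move=> hv a; apply: val_inj; rewrite !rmorphM /=; move: (subalg_valP a) => /=.
move: (subalg_val a); apply: in_subalg_ind => [|c g h hg hh|g h hg hh|_ [[w hw ->]|[v' ->]]].
- by rewrite mul1r mulr1.
- by rewrite mulrDl mulrDr -scalerAl -scalerAr hg hh.
- by rewrite mulrA hg -mulrA hh mulrA.
- have [q + ->] := weyl_parab_word hw.
  elim: q => [|i q IH] /=; first by rewrite hecke_t1 mul1r mulr1.
  move=> /andP [iJ hq]; rewrite hecke_tM; [|exact: weyl_simple|exact: weyl_wmx].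
  rewrite mulrA hecke_xt hv // mulr0 scale0r addr0 cmx_refl_simpleE hv // scale0r subr0.
  by rewrite -mulrA IH // mulrA.
- exact: hecke_xC.
Qed.

Definition cfweight i : 'cV[C]_n := cmx (fweight Phi i).

Lemma shift_cfweight_central g i : i \notin J ->
  forall a : parab H J, GRing.comm (shift px g (cfweight i)) a.
Proof.
move=> iJ a; apply/commr_sym/commrB; last by apply/commr_sym; apply: scalar_comm.
apply/commr_sym/parab_x_central => j jJ; rewrite pairing_cmx scoroot_fweight.
by rewrite (_ : j == i = false) //; apply: contraNF iJ => /eqP <-.
Qed.

Hypothesis irrU : irreducible U.

(** Schur's lemma for the central element [x v - g v]. *)
Lemma weight_central g i : is_weight U g -> i \notin J ->
  forall u : U, shift px g (cfweight i) *: u = 0.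
Proof.
move=> [u u0 [r _ /(_ (cfweight i)) hr]] iJ.
have hz := shift_cfweight_central g iJ.
rewrite -[px _ - _]/(shift px g (cfweight i)) in hr.
set z := shift _ _ _ in hz hr *.
have [y y0 zy] : exists2 y : U, y != 0 & z *: y = 0.
  elim: r u u0 hr => [|r IH] u u0; first by rewrite expr0 scale1r => /eqP; rewrite (negPf u0).
  rewrite exprSr -scalerA => hr; have [zu|zu] := eqVneq (z *: u) 0; first by exists u.
  exact: IH zu hr.
case: irrU => _ /(_ [pred u | z *: u == 0]) [].
- split=> [|a v w]; rewrite !inE ?scaler0 // => /eqP hv /eqP hw.
  by rewrite scalerDr scalerA hz -scalerA hv hw scaler0 addr0.
- by move=> /(_ y); rewrite inE zy eqxx => /(_ isT) e; rewrite e eqxx in y0.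
- by move=> h v; have := h v; rewrite inE => /eqP.
Qed.

Lemma joint_eigenvalue_weight g : joint_eigenvalue U px g -> is_weight U g.
Proof. by move=> [u u0 hu]; exists u => //; exists 1%N. Qed.

Lemma weight_exists : finite_dim U -> exists g, is_weight U g.
Proof.
move=> fdU; have [[|g D] hD hU] := finite_dim_killed parab_xC fdU.
  by have [[u u0] _] := irrU; have /= e := hU u; rewrite e eqxx in u0.
by exists g; apply: joint_eigenvalue_weight; apply: hD; rewrite mem_head.
Qed.

(** Both values are the scalar by which one central element acts on the nonzero module [U]. *)
Lemma weight_fweight g g' i : is_weight U g -> is_weight U g' -> i \notin J ->
  pairing g (cfweight i) = pairing g' (cfweight i).
Proof.
move=> hg hg' iJ; have [[u u0] _] := irrU.
have := weight_central hg iJ u; rewrite -(weight_central hg' iJ u) /shift.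
rewrite !scalerBl => /addrI /oppr_inj /eqP; rewrite -subr_eq0 -scalerBl -scalerBl.
move=> /eqP e; apply/eqP; rewrite -subr_eq0; apply: contraT => h.
have : (((pairing g (cfweight i) - pairing g' (cfweight i))^-1)%:A : parab H J) *:
   ((pairing g (cfweight i) - pairing g' (cfweight i))%:A *: u) = 0 by rewrite e scaler0.
by rewrite scalerA -scalerAl mul1r scalerA mulVf // !scale1r => /eqP; rewrite (negPf u0).
Qed.

Lemma re_weight_pairing (g : 'rV[C]_n) (v : 'cV[R]_n) :
  pairing (re_weight g) v = complex.Re (pairing g (cmx v)).
Proof.
rewrite /pairing !mxE raddf_sum; apply: eq_bigr => j _; rewrite !mxE.
by case: (g 0 j) => a b /=; rewrite mulr0 subr0.
Qed.

Lemma re_weightM (g : 'rV[C]_n) (w : 'M[R]_n) : re_weight (g *m cmx w) = re_weight g *m w.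
Proof.
apply/rowP => i; rewrite !mxE raddf_sum; apply: eq_bigr => j _; rewrite !mxE.
by case: (g 0 j) => a b /=; rewrite mulr0 subr0.
Qed.

Hypotheses (fdU : finite_dim U) (tempU : tempered U).

(** Existence of a weight and temperedness exclude the default value 0 of [xget]. *)
Lemma nuE : exists g a b,
  [/\ is_weight U g, langlands_decomp Phi J (re_weight g) a b
    & nu U = \sum_(i | i \notin J) b i *: coweight Phi i].
Proof.
have [g hg] := weight_exists fdU; have [a [b hab]] := tempU hg.
rewrite /nu; case: xgetP => [y _ [g0 [a0 [b0 [h1 h2 ->]]]]|no]; first by exists g0, a0, b0.
by case: (no (\sum_(i | i \notin J) b i *: coweight Phi i)); exists g, a, b.
Qed.

Lemma weight_le_nu g w : is_weight U g -> coset_min Phi J w ->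
  dominance_le Phi (re_weight (g *m cmx (invmx w))) (nu U).
Proof.
move=> hg hw; have [g0 [a0 [b0 [hg0 h0 ->]]]] := nuE.
have [a [b hab]] := tempU hg; rewrite re_weightM.
rewrite (langlands_nu_unique h0 hab); first exact: langlands_weyl_le hab hw.
by move=> i iJ; rewrite !re_weight_pairing -!/(cfweight i) (weight_fweight hg0 hg iJ).
Qed.

Lemma nu_dominant i : 0 <= pairing (nu U) (simple Phi i).
Proof. by have [g [a [b [_ h ->]]]] := nuE; apply: langlands_nu_dominant h i. Qed.

Lemma standard_killed : exists D,
  (forall g, g \in D -> dominance_le Phi (re_weight g) (nu U)) /\
  (forall y : standard U, killed x D y).
Proof.
have [D hD hU] := finite_dim_killed parab_xC fdU.
have [L hL] := coset_filt_exhaust H J.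
have [E [hE EU]] := standard_killed_filt hU L.
exists E; split=> [g /hE [g' [w [g'D hw ->]]]|].
  by apply: weight_le_nu => //; apply/joint_eigenvalue_weight/hD.
apply: tens_ind => [|y z|h u]; first exact: killed0.
  exact: killedD.
exact: EU.
Qed.

End Weights.

Lemma killed_quotient (K : closedFieldType) (A : algType K) (M L : lmodType A) n
    (x : {linear 'cV[K]_n -> A}) (p : {linear M -> L}) D y :
  killed x D y -> killed x D (p y).
Proof.
elim: D y => [|g D IH] y /=; first by move=> ->; rewrite linear0.
by move=> h v; rewrite -linearZ_LR; apply/IH/h.
Qed.

(** * Vanishing of Ext out of a standard module *)

Section Vanishing.
Variables (R : realType) (n : nat) (Phi : root_system R n) (k : 'I_n -> R[i]).
Variables (H : graded_hecke Phi k) (J : {set 'I_n}) (U : lmodType (parab H J)).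
Hypothesis dataU : langlands_datum U.

Lemma Ext_standard_vanishing (nu' : 'rV[R]_n) (X : lmodType H) D :
  (forall i, 0 <= pairing nu' (simple Phi i)) -> ~ dominance_le Phi (nu U) nu' ->
  (forall g, g \in D -> dominance_le Phi (re_weight g) nu') ->
  (forall y : X, killed (hecke_x H) D y) ->
  forall i, Ext_eq0 (standard U) X i.
Proof.
case: dataU => fdU irrU tempU dom' nle hD DX.
have [g1 [a1 [b1 [hg1 dec1 nu1]]]] := nuE irrU fdU tempU.
(* An index separating [g] from [g1]: if there were none, [langlands_nu_le] would give the excluded
   inequality. *)
have /choice [d hd] : forall g, exists i, g \in D ->
    i \notin J /\ pairing g (cfweight Phi i) != pairing g1 (cfweight Phi i).
  move=> g; have [gD|gD] := pselect (g \in D); last first.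
    (* Outside [D] any index will do; in rank 0 there is none, but then the dominance order holds
       trivially, against [nle]. *)
    have [i|h] := pselect (exists i : 'I_n, True).
      by case: i => i _; exists i.
    case: nle; apply/dominanceP => i; case: h; by exists i.
  apply: contrapT => /forallNP h; apply: nle; rewrite nu1.
  apply: (langlands_nu_le dec1 _ (hD g gD) dom') => i iJ.
  rewrite !re_weight_pairing -!/(cfweight Phi i); congr complex.Re.
  apply/eqP; apply: contrapT => ne; apply: (h i) => _; split=> //.
  by apply/negP; rewrite eq_sym.
have [Q] := proj_resolution_exists U.
(* Chosen so that the shift by [g1] plus [c g] is the shift by [g]: the product over [L] is the one
   that [killed] annihilates on [X]. *)
pose c g := pairing g1 (cfweight Phi (d g)) - pairing g (cfweight Phi (d g)).
pose L := [seq (shift (@parab_x _ _ _ _ H J) g1 (cfweight Phi (d g)), c g) | g <- D].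
apply: (Ext_vanishing (hecke_dual_basis H J) Q (L := L)) => [p /mapP [g gD ->] /=|y].
  have [dJ ne] := hd g gD; split.
  - exact: shift_cfweight_central.
  - by rewrite subr_eq0 eq_sym.
  - exact: weight_central.
rewrite rmorph_prod /L big_map.
rewrite -[RHS](killed_prod (hecke_xC H) (fun g => cfweight Phi (d g)) (DX y)).
congr (_ *: _); apply: eq_bigr => g _.
rewrite /shift /c scalerBl addrA subrK rmorphB /=.
by [].
Qed.

End Vanishing.

Theorem proposition1p1 (R : realType) (n : nat) (Phi : root_system R n)
    (k : 'I_n -> R[i]) (k_inv : parameter_function Phi k)
    (H : graded_hecke Phi k) (J1 J2 : {set 'I_n})
    (U1 : lmodType (parab H J1)) (U2 : lmodType (parab H J2))
    (U1_data : langlands_datum U1) (U2_data : langlands_datum U2)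
    (nu12 : ~ dominance_le Phi (nu U1) (nu U2)) :
  (forall L2 : lmodType H, simple_quotient (standard U2) L2 ->
     forall i : nat, Ext_eq0 (standard U1) L2 i) /\
  (forall i : nat, Ext_eq0 (standard U1) (standard U2) i).
Proof.
case: (U2_data) => fdU2 irrU2 tempU2.
have [D [hD DX]] := standard_killed irrU2 fdU2 tempU2.
have dom2 := nu_dominant irrU2 fdU2 tempU2.
split=> [L2 [_ [p hp]]|]; apply: (Ext_standard_vanishing U1_data dom2 nu12 hD) => //.
by move=> y; have [z <-] := hp y; apply: killed_quotient.
Qed.
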